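(* Let $V$ be an $n$-dimensional vector space over a finite field $\mathbb{F}=\mathbb{F}_q$ of odd characteristic. Let $G\leq\mathrm{GL}(V)$ be a finite group which fixes a hyperplane $H\leq V$ pointwise, let $e_H$ be the maximal order of a diagonalizable reflection in $G$ ($e_H=1$ if there is none), and let $l_H\in V^*$ be a linear form defining $H$. Then there exist basic invariants $f_1,\dots,f_n$ of $G$ (so $\mathbb{F}[V]^G=\mathbb{F}[f_1,\dots,f_n]$ with the $f_i$ algebraically independent) and nonnegative integers $a_1,\dots,a_{n-1}$ such that $(l_H^{e_H})^{a_i}$ divides $df_i$ for $i<n$ and $$\frac{df_1}{(l_H^{e_H})^{a_1}},\ \dots,\ \frac{df_{n-1}}{(l_H^{e_H})^{a_{n-1}}},\ df_n$$ generate $(\Omega^1)^G$ as an $\mathbb{F}[V]^G$-module.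
   Context: $\mathbb{F}[V]=S(V^* )$; $\Omega^1=\mathbb{F}[V]\otimes V^*$ with basis $dz_1,\dots,dz_n$ for a basis $z_i$ of $V^*$; $G$ acts on $V^*$ by $(gf)(v)=f(g^{-1}v)$ and diagonally on $\Omega^1$; $df=\sum_i\frac{\partial f}{\partial z_i}dz_i$. A reflection is a finite-order element of $\mathrm{GL}(V)$ whose fixed space is a hyperplane; it is diagonalizable or else a transvection. *)

(* Defs.v *)
From HB Require Import structures.
From mathcomp Require Import all_boot all_order all_algebra all_fingroup all_field.
From mathcomp Require Import mpoly.
Set Implicit Arguments. Unset Strict Implicit. Unset Printing Implicit Defensive.
Import Order.TTheory GRing.Theory Num.Theory.
Local Open Scope ring_scope.

(* Conventions: V = 'rV[F]_n (row vectors); a matrix g : 'M[F]_n is the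
   linear map v |-> v *m g.  F[V] = {mpoly F[n]}, with 'X_i the coordinate
   function z_i (v |-> v 0 i). *)

Section Defs.
Variables (F : finFieldType) (n : nat).

(* the substitution z_i |-> z_i o A, i.e. z_i |-> sum_j A j i z_j *)
Definition lin_subst (A : 'M[F]_n) : n.-tuple {mpoly F[n]} :=
  [tuple \sum_(j < n) (A j i)%:MP * 'X_j | i < n].

(* (g f)(v) = f(g^{-1} v) *)
Definition act_poly (g : 'M[F]_n) (f : {mpoly F[n]}) : {mpoly F[n]} :=
  comp_mpoly (lin_subst (invmx g)) f.

(* Omega^1 = F[V] (x) V^*, a form sum_i h_i dz_i stored as the row (h_i)_i *)
Definition oneform := 'rV[{mpoly F[n]}]_n.

Definition dfrm (f : {mpoly F[n]}) : oneform := \row_i mderiv i f.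

(* diagonal action: g (h dz_i) = (g h) d(g z_i), g z_i = sum_j (g^-1) j i z_j *)
Definition act_form (g : 'M[F]_n) (w : oneform) : oneform :=
  \row_j \sum_(i < n) act_poly g (w 0 i) * ((invmx g) j i)%:MP.

Definition poly_invariant (G : {set 'M[F]_n}) (f : {mpoly F[n]}) :=
  forall g, g \in G -> act_poly g f = f.

Definition form_invariant (G : {set 'M[F]_n}) (w : oneform) :=
  forall g, g \in G -> act_form g w = w.

Definition has_order (g : 'M[F]_n) (k : nat) :=
  [/\ (0 < k)%N, g ^+ k = 1 & forall j, (0 < j < k)%N -> g ^+ j <> 1].

Definition reflection (g : 'M[F]_n) :=
  [/\ g \in unitmx, exists k, has_order g k &
      \rank (kermx (g - 1%:M)) = n.-1].

Definition diag_reflection (g : 'M[F]_n) := reflection g /\ diagonalizable g.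

Definition max_diag_refl_order (G : {set 'M[F]_n}) (e : nat) :=
  ((forall g, g \in G -> ~ diag_reflection g) /\ e = 1%N) \/
  ((exists2 g, g \in G & diag_reflection g /\ has_order g e) /\
   (forall g k, g \in G -> diag_reflection g -> has_order g k -> (k <= e)%N)).

Definition lin_form_poly (l : 'cV[F]_n) : {mpoly F[n]} :=
  \sum_(i < n) (l i 0)%:MP * 'X_i.

End Defs.

(* Main.v *)
Require Import Defs.
From HB Require Import structures.
From mathcomp Require Import all_boot all_order all_algebra all_fingroup all_field.
From mathcomp Require Import mpoly ring cyclic pgroup abelian.
Import Order.TTheory GRing.Theory Num.Theory.
Local Open Scope ring_scope.
Set Implicit Arguments.
Unset Strict Implicit.
Unset Printing Implicit Defensive.

(* Choose coordinates with l the last one, and so that a generator of the image of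
   det : G -> F^* acts as diag(1, ..., 1, mu), with mu a primitive e-th root of unity;
   the other elements of G are its products with the transvections z_i |-> z_i + b_i l,
   b in a subgroup W of F^n. Let K be the field of scalars preserving W, with q elements;
   it contains mu.

   Starting from x_i = z_i, generators of F[V]^W are built one transvection w at a time.
   They satisfy b x_j = x_j + c_j(b) l^(q^(d_j)) with c_j(t b) = t c_j(b) for t in K. Take
   i with c_i(w) <> 0 and d_i minimal: subtracting multiples of powers of x_i from the
   other x_j, and replacing x_i by the product of its translates under K w, makes all the
   x_j invariant under K w. In the end all c_j vanish. Every step keeps dx_j a multiple of
   du_j (if d_j = 0) or of l du_j - u_j dl (if d_j > 0), where the u_j are linear
   coordinates with u_n = l; the exponents come from these multiples. The basic
   invariants are x_1, ..., x_{n-1} and l^e.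

   If sum_j h_j du_j is invariant, then reducing its invariance modulo l shows that the
   coefficients of the h_j with d_j > 0 on the hyperplane l = 0 give invariant linear
   forms, whose differentials involve those du_j only with coefficients divisible by l.
   So l, and hence l^e, divides these h_j, and subtracting multiples of the given forms
   leaves a multiple of l^(e-1) dl. *)

(** * Composition of polynomials *)

(** Serves as induction on the subalgebra generated by the entries of [t], through sums and products
    instead of monomials. *)
Lemma comp_mpoly_closed (R : comNzRingType) (n k : nat) (t : n.-tuple {mpoly R[k]})
    (S : {mpoly R[k]} -> Prop) :
  (forall c, S c%:MP) -> (forall p q, S p -> S q -> S (p + q)) ->
  (forall p q, S p -> S q -> S (p * q)) -> (forall i, S (tnth t i)) ->
  forall p, S (p \mPo t).
Proof.
move=> SC SD SM St p; rewrite comp_mpolyEX.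
elim/big_ind: _ => [|//|m _]; first by rewrite -mpolyC0.
rewrite -mul_mpolyC comp_mpolyX; apply: (SM) => //.
elim/big_ind: _ => [|//|i _]; first by rewrite -mpolyC1.
by elim: (m i) => [|a IH]; rewrite ?expr0 -?mpolyC1 // exprS; apply: (SM).
Qed.

Lemma mpoly_closed (R : comNzRingType) (n : nat) (S : {mpoly R[n]} -> Prop) :
  (forall c, S c%:MP) -> (forall p q, S p -> S q -> S (p + q)) ->
  (forall p q, S p -> S q -> S (p * q)) -> (forall i, S 'X_i) ->
  forall p, S p.
Proof.
move=> SC SD SM SX p; rewrite -(comp_mpoly_id p).
by apply: comp_mpoly_closed => // i; rewrite tnth_mktuple.
Qed.

Lemma comp_mpoly_tnth (R : comNzRingType) (n k : nat) (t : n.-tuple {mpoly R[k]}) i :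
  'X_i \mPo t = tnth t i.
Proof. by rewrite comp_mpolyXU -tnth_nth. Qed.

Lemma eq_comp_mpoly (R : comNzRingType) (n k : nat) (t u : n.-tuple {mpoly R[k]}) :
  tnth t =1 tnth u -> comp_mpoly t =1 comp_mpoly u.
Proof. by move=> tu p; congr (_ \mPo _); apply: eq_from_tnth. Qed.

Lemma comp_mpolyA (R : comNzRingType) (n k m : nat) (t : n.-tuple {mpoly R[k]})
    (u : k.-tuple {mpoly R[m]}) (p : {mpoly R[n]}) :
  (p \mPo t) \mPo u = p \mPo [tuple tnth t i \mPo u | i < n].
Proof.
elim/mpoly_closed: p => [c|p q|p q|i].
- by rewrite !comp_mpolyC.
- by move=> Ep Eq; rewrite !comp_mpolyD Ep Eq.
- by move=> Ep Eq; rewrite !rmorphM /= Ep Eq.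
- by rewrite !comp_mpoly_tnth tnth_mktuple.
Qed.

Lemma mderivXU (R : comNzRingType) (n : nat) (i j : 'I_n) :
  mderiv j 'X_i = (i == j)%:R :> {mpoly R[n]}.
Proof.
rewrite mderivX mnm1E; case: eqP => [->|_]; last by rewrite scale0r.
have -> : (U_(j) - U_(j) = 0 :> 'X_{1..n})%MM by apply/mnmP => k; rewrite mnmBE subnn mnmE.
by rewrite mpolyX0 scale1r.
Qed.

(** * Differentials, and linear substitutions in polynomials and 1-forms *)

Section Substitution.
Variables (F : finFieldType) (n : nat).
Implicit Types (f g : {mpoly F[n]}) (w : oneform F n) (A B : 'M[F]_n).

Lemma dfrmD f g : dfrm (f + g) = dfrm f + dfrm g.
Proof. by apply/rowP => i; rewrite !mxE mderivD. Qed.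

Lemma dfrmC (c : F) : dfrm c%:MP = 0 :> oneform F n.
Proof. by apply/rowP => i; rewrite !mxE mderivC. Qed.

Lemma dfrmZ c f : dfrm (c *: f) = c%:MP *: dfrm f.
Proof. by apply/rowP => i; rewrite !mxE mderivZ mul_mpolyC. Qed.

Lemma dfrmN f : dfrm (- f) = - dfrm f.
Proof. by apply/rowP => i; rewrite !mxE mderivN. Qed.

Lemma dfrmB f g : dfrm (f - g) = dfrm f - dfrm g.
Proof. by rewrite dfrmD dfrmN. Qed.

Lemma dfrmM f g : dfrm (f * g) = g *: dfrm f + f *: dfrm g.
Proof. by apply/rowP => i; rewrite !mxE mderivM [_ * g]mulrC. Qed.

Lemma dfrm_exp f k : dfrm (f ^+ k) = (f ^+ k.-1 *+ k) *: dfrm f.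
Proof.
elim: k => [|k IH]; first by rewrite mulr0n scale0r expr0 -mpolyC1 dfrmC.
rewrite exprS dfrmM IH scalerA -scalerDl; congr (_ *: _).
by case: k {IH} => [|k]; rewrite ?mulr0n ?mulr0 ?addr0 ?expr0 //= mulrnAr -exprS -mulrS.
Qed.

Lemma dfrmX i : dfrm 'X_i = delta_mx 0 i :> oneform F n.
Proof.
by apply/rowP => j; rewrite !mxE mderivXU eqxx [j == i]eq_sym.
Qed.

Lemma dfrm_comp m (t : m.-tuple {mpoly F[n]}) (p : {mpoly F[m]}) :
  dfrm (p \mPo t) = \sum_(i < m) (mderiv i p \mPo t) *: dfrm (tnth t i).
Proof.
elim/mpoly_closed: p => [c|p q|p q|i].
- by rewrite comp_mpolyC dfrmC big1 // => i _; rewrite mderivC comp_mpoly0 scale0r.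
- move=> Ep Eq; rewrite comp_mpolyD dfrmD Ep Eq -big_split.
  by apply: eq_bigr => i _; rewrite mderivD comp_mpolyD scalerDl.
- move=> Ep Eq; rewrite rmorphM dfrmM Ep Eq !scaler_sumr -big_split.
  apply: eq_bigr => i _ /=; rewrite mderivM comp_mpolyD !rmorphM /= scalerDl !scalerA.
  by rewrite [(q \mPo t) * _]mulrC.
- rewrite comp_mpoly_tnth (bigD1 i) //= big1 ?addr0 => [|j ji].
    by rewrite mderivXU eqxx comp_mpoly1 scale1r.
  by rewrite mderivXU eq_sym (negbTE ji) comp_mpoly0 scale0r.
Qed.

(** For invertible [B] this is [act_poly] of the inverse of [B]; keeping inverses out lets
    substitutions compose as [B *m A] for all matrices. *)
Definition msubst B f := f \mPo lin_subst B.

HB.instance Definition _ B := GRing.RMorphism.copy (msubst B)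
  (comp_mpoly (lin_subst B)).

Lemma msubstC B c : msubst B c%:MP = c%:MP.
Proof. exact: comp_mpolyC. Qed.

Lemma msubstZ B c f : msubst B (c *: f) = c *: msubst B f.
Proof. exact: comp_mpolyZ. Qed.

Lemma msubstX B i : msubst B 'X_i = \sum_j B j i *: 'X_j.
Proof.
rewrite /msubst comp_mpoly_tnth tnth_mktuple.
by apply: eq_bigr => j _; rewrite mul_mpolyC.
Qed.

Lemma msubst_mul A B f : msubst B (msubst A f) = msubst (B *m A) f.
Proof.
rewrite /msubst comp_mpolyA; apply: eq_comp_mpoly => i.
rewrite !tnth_mktuple; have -> (p : {mpoly F[n]}) : p \mPo lin_subst B = msubst B p by [].
rewrite rmorph_sum /=.
under eq_bigr => j _ do rewrite rmorphM /= msubstC msubstX mul_mpolyC scaler_sumr.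
rewrite exchange_big /=; apply: eq_bigr => k _.
rewrite mxE mul_mpolyC scaler_suml; apply: eq_bigr => j _.
by rewrite scalerA mulrC.
Qed.

Lemma msubst1 f : msubst 1%:M f = f.
Proof.
rewrite -{2}(comp_mpoly_id f); apply: eq_comp_mpoly => i.
rewrite !tnth_mktuple (bigD1 i) //= big1 ?addr0 => [|j ji]; rewrite mxE.
  by rewrite eqxx mpolyC1 mul1r.
by rewrite (negbTE ji) mpolyC0 mul0r.
Qed.

Definition fsubst B w : oneform F n :=
  \row_j \sum_(i < n) msubst B (w 0 i) * (B j i)%:MP.

Lemma fsubstD B w v : fsubst B (w + v) = fsubst B w + fsubst B v.
Proof.
apply/rowP => j; rewrite !mxE -big_split; apply: eq_bigr => i _ /=.
by rewrite mxE rmorphD mulrDl.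
Qed.

Lemma fsubstZ B f w : fsubst B (f *: w) = msubst B f *: fsubst B w.
Proof.
apply/rowP => j; rewrite !mxE mulr_sumr; apply: eq_bigr => i _ /=.
by rewrite mxE rmorphM mulrA.
Qed.

Lemma fsubst0 B : fsubst B 0 = 0.
Proof. by rewrite -(scale0r 0) fsubstZ rmorph0 !scale0r. Qed.

Lemma fsubstN B w : fsubst B (- w) = - fsubst B w.
Proof. by apply/eqP; rewrite -addr_eq0 -fsubstD addNr fsubst0. Qed.

Lemma fsubst_sum B (I : Type) (r : seq I) (P : pred I) (w : I -> oneform F n) :
  fsubst B (\sum_(i <- r | P i) w i) = \sum_(i <- r | P i) fsubst B (w i).
Proof.
elim/big_rec2: _ => [|i v u _ <-]; [exact: fsubst0 | exact: fsubstD].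
Qed.

Lemma dfrm_msubst B f : dfrm (msubst B f) = fsubst B (dfrm f).
Proof.
rewrite dfrm_comp; apply/rowP => j; rewrite summxE !mxE; apply: eq_bigr => i _.
rewrite !mxE tnth_mktuple; congr (_ * _).
rewrite raddf_sum (bigD1 j) //= big1 ?addr0 => [|k kj];
  rewrite mul_mpolyC mderivZ mderivXU.
  by rewrite eqxx alg_mpolyC.
by rewrite (negbTE kj) scaler0.
Qed.

Lemma form_delta w : w = \sum_i w 0 i *: dfrm 'X_i.
Proof. by rewrite {1}[w]row_sum_delta; apply: eq_bigr => i _; rewrite dfrmX. Qed.

Lemma fsubst_mul A B w : fsubst B (fsubst A w) = fsubst (B *m A) w.
Proof.
rewrite (form_delta w) !fsubst_sum; apply: eq_bigr => i _.
by rewrite !fsubstZ -!dfrm_msubst !msubst_mul.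
Qed.

Lemma fsubst1 w : fsubst 1%:M w = w.
Proof.
rewrite {2}(form_delta w) {1}(form_delta w) fsubst_sum; apply: eq_bigr => i _.
by rewrite fsubstZ -dfrm_msubst !msubst1.
Qed.

End Substitution.

(** * Jacobian criterion in positive characteristic, and descent of a value to a base ring *)

Lemma msize_exp_pred (R : idomainType) (n : nat) (p : {mpoly R[n]}) k :
  p != 0 -> (msize (p ^+ k)).-1 = (k * (msize p).-1)%N.
Proof.
move=> p0; elim: k => [|k IH]; first by rewrite expr0 msize1.
have sp: (0 < msize p)%N by rewrite lt0n msize_poly_eq0.
have sk: (0 < msize (p ^+ k))%N by rewrite lt0n msize_poly_eq0 expf_neq0.
rewrite exprS msizeM ?expf_neq0 // mulSn -IH.
by case: (msize p) sp => // a _; case: (msize _) sk => // b _; rewrite addSn addnS.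
Qed.

Lemma msize_mderiv_lt (R : comNzRingType) (n : nat) (p : {mpoly R[n]}) i :
  p != 0 -> (msize (mderiv i p) < msize p)%N.
Proof.
move=> p0; have [-> | d0] := eqVneq (mderiv i p) 0.
  by rewrite msize0 lt0n msize_poly_eq0.
rewrite -mlead_deg //; set m := mlead _.
have : m \in msupp (mderiv i p) by rewrite mlead_supp.
rewrite mcoeff_msupp mcoeff_mderiv => dm.
have : (m + U_(i))%MM \in msupp p.
  by rewrite mcoeff_msupp; apply: contraNneq dm => ->; rewrite mul0rn.
by move/msize_mdeg_lt; rewrite mdegD mdeg1 addn1.
Qed.

Lemma finField_pchar_root (F : finFieldType) ch (c : F) :
  ch \in [pchar F] -> exists r, r ^+ ch = c.
Proof.
move=> chF; have [g _ gK] := injF_bij (fmorph_inj (pFrobenius_aut chF)).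
by exists (g c); apply: gK.
Qed.

(** Vanishing partial derivatives make every exponent in the support a multiple of [ch]. The root is
    then taken term by term: Frobenius is onto on a finite field and additive on polynomials. *)
Lemma mderiv0_pchar_exp (F : finFieldType) (n : nat) (p : {mpoly F[n]}) ch :
  ch \in [pchar F] -> (forall i, mderiv i p = 0) -> exists r, p = r ^+ ch.
Proof.
move=> chF dp.
have rt c : {r : F | r ^+ ch == c}.
  by apply: sigW; have [r <-] := finField_pchar_root c chF; exists r.
have chP : ch \in [pchar {mpoly F[n]}].
  apply/andP; split; first exact: pcharf_prime chF.
  by rewrite -mpolyC_nat pcharf0 ?mpolyC0.
have dvd m i : m \in msupp p -> (ch %| m i)%N.
  rewrite mcoeff_msupp => pm; case mi: (m i) => [|k]; first by rewrite dvdn0.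
  have Um : (m = (m - U_(i)) + U_(i))%MM.
    apply/mnmP => j; rewrite mnmDE mnmBE mnm1E.
    by case: eqP => [<-|_]; rewrite ?mi ?subn0 ?addn0 // subn1 addn1.
  have := congr1 (mcoeff (m - U_(i))%MM) (dp i).
  rewrite mcoeff_mderiv -Um mcoeff0 mnmBE mnm1E eqxx mi subn1 /=.
  rewrite -mulr_natr => /eqP; rewrite mulf_eq0 (negbTE pm) /=.
  by rewrite (dvdn_pcharf chF).
exists (\sum_(m <- msupp p) sval (rt p@_m) *: 'X_[[multinom (m i %/ ch)%N | i < n]]).
rewrite -(pFrobenius_autE chP) rmorph_sum {1}(mpolyE p) /=.
rewrite [LHS]big_seq [RHS]big_seq; apply: eq_bigr => m pm.
rewrite pFrobenius_autE exprZn (eqP (svalP (rt _))) mpolyXn; congr (_ *: 'X_[_]).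
by apply/mnmP => i; rewrite mulmnE mnmE divnK // dvd.
Qed.

(* Jacobian criterion: a relation of least degree has vanishing partial derivatives,
   so it is a p-th power of a smaller relation. *)
Lemma dfrm_alg_indep (F : finFieldType) (n k : nat) (t : n.-tuple {mpoly F[k]}) :
  (forall c : 'I_n -> {mpoly F[k]},
     \sum_i c i *: dfrm (tnth t i) = 0 -> forall i, c i = 0) ->
  forall p, p \mPo t = 0 -> p = 0.
Proof.
move=> ind p; have [a] := ubnP (msize p); elim: a p => // a IH p sp tp0.
apply/eqP/negPn/negP => p0.
have [sp1 | sp1] := leqP (msize p) 1.
  move: tp0 p0; rewrite (msize1_polyC sp1) comp_mpolyC => /eqP.
  by rewrite !mpolyC_eq0 => ->.
have dp i : mderiv i p = 0.
  apply: IH; first exact: leq_trans (msize_mderiv_lt i p0) _.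
  apply: (ind (fun i => mderiv i p \mPo t)).
  by rewrite -dfrm_comp tp0 -mpolyC0 dfrmC.
have [ch chP chF] := finPcharP F.
have [r pr] := mderiv0_pchar_exp chF dp.
have r0 : r != 0 by apply: contraNneq p0 => r0; rewrite pr r0 expr0n; case: ch chP {chF pr}.
have sr : (msize r < msize p)%N.
  have /= := congr1 (fun q : {mpoly F[n]} => (msize q).-1) pr.
  rewrite msize_exp_pred //; have c1 := prime_gt1 chP.
  move: sp1; case: (msize p) => [|[|b]] //= _ Eb.
  case: (msize r) Eb => [|[|c]] //= Eb.
  by rewrite !ltnS -ltnS Eb ltn_Pmull.
have := IH r (leq_trans sr _); rewrite -ltnS => /(_ sp) Hr.
move: tp0; rewrite pr rmorphXn /= => /eqP; rewrite expf_eq0 => /andP[_ /eqP/Hr].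
by move/eqP; rewrite (negbTE r0).
Qed.

(* Dividing the expression of h by the monic polynomial rho leaves a polynomial
   of degree smaller than the number of points where it takes the value h. *)
Lemma descent_to_base (R : comNzRingType) (A : idomainType) (phi : {rmorphism R -> A})
    (rho : {poly R}) (s : seq A) (Q : {poly R}) (h : A) :
  rho \is monic -> uniq s -> (0 < size s)%N -> (size rho <= (size s).+1)%N ->
  (forall x, x \in s -> root (map_poly phi rho) x /\ (map_poly phi Q).[x] = h) ->
  exists r, h = phi r.
Proof.
move=> mon us s0 ss xs; pose T := Pdiv.Ring.rmodp Q rho.
pose P := map_poly phi T - h%:P.
have sT : (size T <= size s)%N.
  by rewrite -ltnS (leq_trans _ ss) // Pdiv.Ring.ltn_rmodpN0 ?monic_neq0.
suff P0 : P = 0.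
  exists T`_0; have := congr1 (fun q : {poly A} => q`_0) P0.
  by rewrite /P coefB coef_map coefC coef0 /= => /eqP; rewrite subr_eq0 => /eqP.
apply: (@roots_geq_poly_eq0 _ _ s) => //; last first.
  apply: leq_trans (size_polyD _ _) _; rewrite geq_max size_polyN.
  rewrite (leq_trans (size_poly _ _)) //.
  by rewrite (leq_trans (size_polyC_leq1 _)).
apply/allP => x /xs[/eqP rx Qx]; rewrite /P rootE !hornerE.
have := Pdiv.RingMonic.rdivp_eq mon Q; rewrite -/T => EQ.
by move: Qx; rewrite EQ rmorphD rmorphM /= !hornerE rx mulr0 add0r => ->; rewrite subrr.
Qed.

Lemma prim_root_neq0 (F : fieldType) e (mu : F) : e.-primitive_root mu -> mu != 0.
Proof.
move=> mue; apply/eqP => mu0; have /eqP := prim_expr_order mue.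
by rewrite mu0 expr0n gtn_eqF ?(prim_order_gt0 mue) //= eq_sym oner_eq0.
Qed.

(** * Shears and dilations along the hyperplane l = 0, with l the last variable *)

Section LastVariable.
Variables (F : finFieldType) (n : nat).
Notation mp := {mpoly F[n.+1]}.
Notation l := ('X_(@ord_max n) : mp).
Implicit Types (f g : mp) (b : 'rV[F]_n.+1).

(** This is v |-> v + l(v) b, the general matrix fixing the hyperplane l = 0 pointwise. If the last
    coordinate of [b] is 0 it is a transvection or the identity. *)
Definition shear b : 'M[F]_n.+1 := 1%:M + delta_mx ord_max (0 : 'I_1) *m b.

Definition dilation mu : 'M[F]_n.+1 :=
  diag_mx (\row_j if j == ord_max then mu else 1).

Lemma mpolyX_neq0 i : ('X_i : mp) != 0.
Proof. by rewrite -msize_poly_eq0 msizeX. Qed.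

Lemma shearE b j i : shear b j i = (j == i)%:R + (j == ord_max)%:R * b 0 i.
Proof. by rewrite !mxE big_ord1 !mxE eqxx andbT. Qed.

Lemma msubst_shearX b i : msubst (shear b) 'X_i = 'X_i + b 0 i *: l.
Proof.
rewrite msubstX; under eq_bigr => j _ do rewrite shearE scalerDl.
rewrite big_split /= (bigD1 i) //= eqxx scale1r big1 ?addr0 => [|j /negbTE->]; last first.
  by rewrite scale0r.
congr (_ + _); rewrite (bigD1 ord_max) //= eqxx mul1r big1 ?addr0 // => j /negbTE->.
by rewrite mul0r scale0r.
Qed.

Lemma msubst_dilationX mu i :
  msubst (dilation mu) 'X_i = (if i == ord_max then mu else 1) *: 'X_i.
Proof.
rewrite msubstX (bigD1 i) //= big1 ?addr0 => [|j ji]; last first.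
  by rewrite !mxE (negbTE ji) mulr0n scale0r.
by rewrite !mxE eqxx mulr1n.
Qed.

Lemma msubst_dilation_monom mu m :
  msubst (dilation mu) 'X_[m] = mu ^+ m ord_max *: 'X_[m].
Proof.
rewrite [in LHS]mpolyXE_id rmorph_prod.
under eq_bigr => i _ do rewrite rmorphXn /= msubst_dilationX exprZn.
rewrite scaler_prod /= -mpolyXE_id (bigD1 ord_max) //= eqxx.
by rewrite big1 ?mulr1 // => i /negbTE->; rewrite expr1n.
Qed.

Lemma mcoeff_dilation mu f m :
  (msubst (dilation mu) f)@_m = mu ^+ m ord_max * f@_m.
Proof.
rewrite {1}(mpolyE f) rmorph_sum [in RHS](mpolyE f) /=.
rewrite !raddf_sum mulr_sumr.
apply: eq_bigr => k _; rewrite /= msubstZ msubst_dilation_monom !mcoeffZ mcoeffX.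
by case: eqP => [->|_]; rewrite ?mulr0 ?mulr1 // mulrC.
Qed.

Lemma mpolyX_exp_dvd (i : 'I_n.+1) r f :
  (forall m, m \in msupp f -> (r <= m i)%N) -> exists g, f = 'X_i ^+ r * g.
Proof.
move=> fr; exists (\sum_(m <- msupp f) f@_m *: 'X_[m - U_(i) *+ r]).
rewrite {1}(mpolyE f) mulr_sumr big_seq [RHS]big_seq; apply: eq_bigr => m fm.
rewrite -scalerAr mpolyXn -mpolyXD; congr (_ *: 'X_[_]); apply/mnmP => j.
rewrite mnmDE mnmBE mulmnE mnm1E; case: eqP => [<-|_]; last by rewrite mul0n subn0.
by rewrite mul1n subnKC // fr.
Qed.

(** The dilation scales each monomial by [mu] to the power of its l-exponent. On the support of [f]
    this exponent is thus congruent to [r] modulo [e], hence at least [r]. *)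
Lemma dilation_semi_invariant mu e r f :
  e.-primitive_root mu -> (r < e)%N -> msubst (dilation mu) f = mu ^+ r *: f ->
  exists2 g, f = l ^+ r * g & msubst (dilation mu) g = g.
Proof.
move=> mue re sf.
have mu0 := prim_root_neq0 mue.
have [g fE] : exists g, f = l ^+ r * g.
  apply: mpolyX_exp_dvd => m; rewrite mcoeff_msupp => fm.
  have /eqP := congr1 (mcoeff m) sf; rewrite mcoeff_dilation mcoeffZ.
  rewrite (inj_eq (mulIf fm)) (eq_prim_root_expr mue) => /eqP mr.
  by rewrite -(modn_small re) -mr leq_mod.
exists g => //; move: sf; rewrite fE rmorphM rmorphXn /= msubst_dilationX eqxx.
rewrite exprZn -scalerAl => /(scalerI (expf_neq0 r mu0)).
exact/mulfI/expf_neq0/mpolyX_neq0.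
Qed.

(** By the same comparison of coefficients, [e] divides every l-exponent occurring in [f]. *)
Lemma dilation_invariant mu e f :
  e.-primitive_root mu -> msubst (dilation mu) f = f ->
  exists g, f = g \mPo [tuple if i == ord_max then l ^+ e else 'X_i | i < n.+1].
Proof.
move=> mue sf.
pose dv (m : 'X_{1..n.+1}) := [multinom if i == ord_max then m i %/ e else m i | i < n.+1]%N.
exists (\sum_(m <- msupp f) f@_m *: 'X_[dv m]).
rewrite {1}(mpolyE f) rmorph_sum big_seq [RHS]big_seq; apply: eq_bigr => m fm /=.
rewrite comp_mpolyZ comp_mpolyX mpolyXE_id; congr (_ *: _); apply: eq_bigr => i _.
rewrite tnth_mktuple mnmE; case: eqP => [-> |//]; rewrite -exprM mulnC divnK //.
rewrite mcoeff_msupp in fm; have /eqP := congr1 (mcoeff m) sf.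
by rewrite mcoeff_dilation -{2}[f@_m]mul1r (inj_eq (mulIf fm)) -(prim_order_dvd mue).
Qed.

Definition at_wall f : mp := f \mPo [tuple if i == ord_max then 0 else 'X_i | i < n.+1].

HB.instance Definition _ := GRing.RMorphism.copy at_wall
  (comp_mpoly [tuple if i == ord_max then 0 else 'X_i | i < n.+1]).

Lemma at_wallX i : at_wall 'X_i = if i == ord_max then 0 else 'X_i.
Proof. by rewrite /at_wall comp_mpoly_tnth tnth_mktuple. Qed.

Lemma at_wall_split f : exists g, f = at_wall f + l * g.
Proof.
elim/mpoly_closed: f => [c|p q [p' Ep] [q' Eq]|p q [p' Ep] [q' Eq]|i].
- by exists 0; rewrite mulr0 addr0 [at_wall _]comp_mpolyC.
- by exists (p' + q'); rewrite {1}Ep {1}Eq rmorphD; ring.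
- exists (at_wall p * q' + p' * at_wall q + l * p' * q').
  by rewrite {1}Ep {1}Eq rmorphM; ring.
- rewrite at_wallX; case: eqP => [->|_]; first by exists 1; rewrite add0r mulr1.
  by exists 0; rewrite mulr0 addr0.
Qed.

Lemma at_wall_mull g : at_wall (l * g) = 0.
Proof. by rewrite rmorphM /= at_wallX eqxx mul0r. Qed.

Lemma at_wall_eq0 f : at_wall f = 0 -> exists g, f = l * g.
Proof. by have [g {2}->] := at_wall_split f => ->; exists g; rewrite add0r. Qed.

Lemma shear_split b f : exists g, msubst (shear b) f = f + l * g.
Proof.
elim/mpoly_closed: f => [c|p q [p' Ep] [q' Eq]|p q [p' Ep] [q' Eq]|i].
- by exists 0; rewrite mulr0 addr0 msubstC.
- by exists (p' + q'); rewrite rmorphD /= Ep Eq; ring.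
- by exists (p * q' + p' * q + l * p' * q'); rewrite rmorphM /= Ep Eq; ring.
- by exists (b 0 i)%:MP; rewrite msubst_shearX mulrC mul_mpolyC.
Qed.

End LastVariable.

(** * Generators of the invariants of the transvection group, one transvection at a time *)

Section Tower.
Variables (F : finFieldType) (n : nat).
Notation mp := {mpoly F[n.+1]}.
Notation l := ('X_(@ord_max n) : mp).
Variables (W : {set 'rV[F]_n.+1}) (K : {set F}) (q ch : nat) (mu : F).
Hypotheses (chF : ch \in [pchar F]) (q_ch : ch.-nat q) (q_gt1 : (1 < q)%N).
Hypothesis W_scale : forall t b, t \in K -> b \in W -> t *: b \in W.
Hypothesis W_max : forall b, b \in W -> b 0 ord_max = 0.
Hypotheses (K_exp : forall t, t \in K -> t ^+ q = t) (K_card : #|K| = q).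
Hypothesis mu_exp : mu ^+ q.-1 = 1.
Implicit Types (f g h : mp) (b w r : 'rV[F]_n.+1).

Definition linform r : mp := \sum_k r 0 k *: 'X_k.

Lemma linformD r b : linform (r + b) = linform r + linform b.
Proof. by rewrite -big_split; apply: eq_bigr => k _; rewrite mxE scalerDl. Qed.

Lemma linformZ a r : linform (a *: r) = a *: linform r.
Proof. by rewrite scaler_sumr; apply: eq_bigr => k _; rewrite mxE scalerA. Qed.

Lemma linformB r b : linform (r - b) = linform r - linform b.
Proof. by rewrite -scaleN1r linformD linformZ scaleN1r. Qed.

Lemma linform_delta i : linform (delta_mx 0 i) = 'X_i.
Proof.
rewrite /linform (bigD1 i) //= big1 ?addr0 => [|j ji].
  by rewrite mxE !eqxx scale1r.
by rewrite mxE (negbTE ji) scale0r.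
Qed.

Definition shear_invariant h := forall b, b \in W -> msubst (shear b) h = h.

(* A linear form x has d(x^q - (C l)^(q-1) x) = - C^(q-1) l^(q-2) (l dx - x dl), as q = 0
   in F; later steps only multiply this by powers of l. *)
Definition differential_shape d r f :=
  if d == 0%N then f = linform r
  else dfrm f = l ^+ (q ^ d - 2) *: (l *: dfrm (linform r) - linform r *: dfrm l).

(** The rows of [M] are the linear coordinates u_j of the differential shapes. Its last row makes
    u_n = l, and its last column keeps z_n out of the other u_j, so that the dilation fixes them.
    The x_j need not be invariant under [W] until all c_j vanish: [tower_gen] only says that the
    invariants are polynomials in them. *)
Record tower (x : 'I_n.+1 -> mp) (d : 'I_n.+1 -> nat)
    (c : 'I_n.+1 -> 'rV[F]_n.+1 -> F) (M : 'M[F]_n.+1) : Prop := Tower {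
  tower_max : [/\ x ord_max = l, d ord_max = 0%N,
    forall b, b \in W -> c ord_max b = 0 & row ord_max M = delta_mx 0 ord_max];
  tower_unit : M \in unitmx;
  tower_col : forall j, j != ord_max -> M j ord_max = 0;
  tower_homog : forall j, x j \is (q ^ d j).-homog;
  tower_dil : forall j, j != ord_max -> msubst (dilation n mu) (x j) = x j;
  tower_shear : forall j b, b \in W ->
    msubst (shear b) (x j) = x j + c j b *: l ^+ (q ^ d j);
  tower_scale : forall j t b, t \in K -> b \in W -> c j (t *: b) = t * c j b;
  tower_diff : forall j, differential_shape (d j) (row j M) (x j);
  tower_gen : forall h, shear_invariant h -> exists Q, h = Q \mPo [tuple x i | i < n.+1] }.

Lemma tower_start :
  tower (fun i => 'X_i) (fun=> 0%N) (fun i b => b 0 i) 1%:M.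
Proof.
split => //.
- by split=> //; apply/rowP => j; rewrite !mxE eqxx eq_sym.
- exact: unitmx1.
- by move=> j /negbTE jm; rewrite mxE jm.
- by move=> j; rewrite dhomogX; apply/eqP/mdeg1.
- by move=> j /negbTE jm; rewrite msubst_dilationX jm scale1r.
- by move=> j b bW; rewrite msubst_shearX expr1.
- by move=> j t b _ _; rewrite mxE.
- by move=> j; rewrite /differential_shape eqxx row1 linform_delta.
- by move=> h _; exists h; rewrite comp_mpoly_id.
Qed.

Lemma pchar_mpoly : ch \in [pchar mp].
Proof.
apply/andP; split; first exact: pcharf_prime chF.
by rewrite -mpolyC_nat pcharf0 ?mpolyC0.
Qed.

Lemma exprDq (A : comNzRingType) (chA : ch \in [pchar A]) k :
  {morph (fun y : A => y ^+ (q ^ k)) : x y / x + y}.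
Proof.
by move=> x y; rewrite exprDn_pchar // (eq_pnat _ (pcharf_eq chA)) pnatX q_ch.
Qed.

Lemma q_natr0 k : (0 < k)%N -> (q ^ k)%:R = 0 :> mp.
Proof.
move=> k0; apply/eqP; rewrite -(dvdn_pcharf pchar_mpoly).
rewrite (dvdn_trans _ (dvdn_exp k0 (dvdnn q))) //.
move: q_ch; rewrite /pnat => /andP[q0 /allP qp].
have pq : pdiv q \in primes q by rewrite mem_primes pdiv_prime // q0 pdiv_dvd.
by have := qp _ pq; rewrite inE => /eqP <-; rewrite pdiv_dvd.
Qed.

Lemma K_exp_iter t k : t \in K -> t ^+ (q ^ k) = t.
Proof.
move=> tK; elim: k => [|k IH]; first by rewrite expr1.
by rewrite expnS exprM K_exp.
Qed.

Lemma linform_row_combination r r' k : linform (r - k *: r') = linform r - k *: linform r'.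
Proof. by rewrite linformB linformZ. Qed.

(** This and the next two identities are stated over an abstract ring so that [ring] can settle them
    entry by entry. *)
Lemma koszul_row_sub (R : comNzRingType) m (A L a b k : R) (X Y Z : 'rV[R]_m) :
  A *: (L *: X - a *: Z) - k *: (A *: (L *: Y - b *: Z)) =
  A *: (L *: (X - k *: Y) - (a - k * b) *: Z).
Proof. by apply/rowP => i; rewrite !mxE; ring. Qed.

Lemma koszul_row_neg0 (R : comNzRingType) m (A L a f : R) (X Z : 'rV[R]_m) :
  - (a *: (f *: ((A * -1) *: Z) + (L * A) *: X)) = A *: (L *: (- a *: X) - (- a * f) *: Z).
Proof. by apply/rowP => i; rewrite !mxE; ring. Qed.

Lemma koszul_row_neg (R : comNzRingType) m (A B L a f : R) (X Z : 'rV[R]_m) :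
  - (a *: (A *: (B *: (L *: X - f *: Z)))) =
  (A * B) *: (L *: (- a *: X) - (- a * f) *: Z).
Proof. by apply/rowP => i; rewrite !mxE; ring. Qed.

Lemma differential_shape_sub d r r' f f' k :
  differential_shape d r f -> differential_shape d r' f' ->
  differential_shape d (r - k *: r') (f - k *: f').
Proof.
rewrite /differential_shape linform_row_combination.
case: eqP => _ Ef Ef'; first by rewrite Ef Ef'.
rewrite !(dfrmB, dfrmZ) Ef Ef' -!mul_mpolyC.
exact: koszul_row_sub.
Qed.

(** The power [f ^+ q] has differential 0. For [d = 0], differentiating [l ^+ q.-1] gives the factor
    q - 1 = -1, which creates the combination l du - u dl. For [d > 0] the power of l has
    differential 0 as well, so the old shape is only multiplied by it. *)
Lemma differential_shape_artin_schreier d r f C : C != 0 ->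
  differential_shape d r f ->
  differential_shape d.+1 ((- C ^+ q.-1) *: r) (f ^+ q - (C *: l ^+ (q ^ d)) ^+ q.-1 * f).
Proof.
move=> C0; rewrite /differential_shape /= linformZ => Ef.
have Q0 : (0 < q ^ d)%N by rewrite expn_gt0 ltnW.
have q0 : q%:R = 0 :> mp by have := q_natr0 (isT : (0 < 1)%N); rewrite expn1.
rewrite dfrmB dfrm_exp -mulr_natr q0 mulr0 scale0r sub0r.
rewrite exprZn -exprM -scalerAl dfrmZ dfrmM dfrmZ dfrm_exp -mulr_natr.
case: eqP Ef => [-> ->|/eqP d0 ->].
  rewrite expn0 mul1n expn1; case: q q_gt1 q0 => [|[|k]] // _ q0; rewrite /= !subSS subn0.
  have kE : k.+1%:R = -1 :> mp by apply/eqP; rewrite -subr_eq0 opprK -mulrSr q0.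
  by rewrite kE -?mul_mpolyC mpolyCN !exprS; apply: koszul_row_neg0.
have -> : (q ^ d * q.-1)%:R = 0 :> mp by rewrite natrM q_natr0 ?mul0r // lt0n.
rewrite mulr0 scale0r scaler0 add0r.
have -> : (q ^ d.+1 - 2 = q ^ d * q.-1 + (q ^ d - 2))%N.
  have Q2 : (2 <= q ^ d)%N by rewrite (leq_trans q_gt1) // -{1}(expn1 q) leq_exp2l // lt0n.
  by rewrite addnBA // -mulnSr prednK ?(ltnW q_gt1) // expnSr.
by rewrite exprD -?mul_mpolyC mpolyCN; apply: koszul_row_neg.
Qed.

Lemma shear_wall b : b \in W -> msubst (shear b) l = l.
Proof. by move=> bW; rewrite msubst_shearX W_max // scale0r addr0. Qed.

Lemma comp_mpoly_fixed (x : 'I_n.+1 -> mp) b :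
  (forall j, msubst (shear b) (x j) = x j) ->
  forall p, msubst (shear b) (p \mPo [tuple x i | i < n.+1]) = p \mPo [tuple x i | i < n.+1].
Proof.
move=> xb p; rewrite {1}/msubst comp_mpolyA; apply: eq_comp_mpoly => i.
by rewrite !tnth_mktuple; apply: xb.
Qed.

(* With y the Artin-Schreier root x_{i0}, the translates of y by K w are the roots
   of one monic polynomial over the new ring, and h takes the same value at all of them. *)
Lemma descent_step (x x' : 'I_n.+1 -> mp) (i0 : 'I_n.+1) (w : 'rV[F]_n.+1)
    (C : F) (D : nat) (kap : 'I_n.+1 -> F) (m : 'I_n.+1 -> nat) h :
  C != 0 -> w \in W -> x' ord_max = l ->
  (forall t, t \in K -> msubst (shear (t *: w)) (x i0) = x i0 + (t * C) *: l ^+ (q ^ D)) ->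
  (forall t j, t \in K -> msubst (shear (t *: w)) (x' j) = x' j) ->
  x' i0 = x i0 ^+ q - (C *: l ^+ (q ^ D)) ^+ q.-1 * x i0 ->
  (forall j, j != i0 -> x' j = x j - kap j *: x i0 ^+ m j) ->
  shear_invariant h -> (exists Q, h = Q \mPo [tuple x i | i < n.+1]) ->
  exists Q, h = Q \mPo [tuple x' i | i < n.+1].
Proof.
move=> C0 wW x'max ytw x'tw x'i0 x'j hinv [P hP].
set y := x i0 in ytw x'i0 x'j *; set L := l ^+ (q ^ D) in ytw x'i0 *.
have L0 : L != 0 by rewrite expf_neq0 // mpolyX_neq0.
have [phi phiE] : {phi : {rmorphism mp -> mp} | forall p, phi p = p \mPo [tuple x' i | i < n.+1]}.
  by exists (comp_mpoly [tuple x' i | i < n.+1]).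
have phiX j : phi 'X_j = x' j by rewrite phiE comp_mpoly_tnth tnth_mktuple.
(* Every old generator is a polynomial in [y] over the new ring, by the relations [x'j]; hence so is
   [h]. *)
have [Q EQ] : exists Q, (map_poly phi Q).[y] = h.
  rewrite hP; elim/comp_mpoly_closed: _ => [c|a b [A EA] [B EB]|a b [A EA] [B EB]|j].
  - by exists (c%:MP)%:P; rewrite map_polyC hornerC /= phiE comp_mpolyC.
  - by exists (A + B); rewrite rmorphD hornerD EA EB.
  - by exists (A * B); rewrite rmorphM hornerM EA EB.
  - rewrite tnth_mktuple; case: (eqVneq j i0) => [->|ji].
      by exists 'X; rewrite map_polyX hornerX.
    exists (('X_j)%:P + ((kap j)%:MP)%:P * 'X^(m j)).
    rewrite rmorphD rmorphM /= !map_polyC map_polyXn !hornerE /= phiX x'j //.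
    by rewrite phiE comp_mpolyC mul_mpolyC subrK.
pose A : mp := (C *: l ^+ (q ^ D)) ^+ q.-1.
have phiA : phi A = (C *: L) ^+ q.-1.
  by rewrite /A phiE rmorphXn /= comp_mpolyZ rmorphXn /= comp_mpoly_tnth tnth_mktuple x'max.
pose rho : {poly mp} := 'X^q - (A%:P * 'X + ('X_i0)%:P).
have srho : (size (- (A%:P * 'X + ('X_i0)%:P : {poly mp})) < size ('X^q : {poly mp}))%N.
  rewrite size_polyN size_polyXn ltnS (leq_trans _ q_gt1) //.
  by rewrite size_MXaddC; case: ifP => // _; rewrite ltnS size_polyC_leq1.
suff [g ->] : exists g, h = phi g by exists g; rewrite phiE.
apply: (@descent_to_base _ _ phi rho [seq y + (t * C) *: L | t <- enum K] Q).
- by rewrite monicE lead_coefDl // lead_coefXn.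
- rewrite map_inj_uniq ?enum_uniq // => s t /addrI /eqP.
  by rewrite -subr_eq0 -scalerBl scaler_eq0 (negbTE L0) orbF subr_eq0 => /eqP /(mulIf C0).
- by rewrite size_map -cardE K_card ltnW.
- by rewrite size_map -cardE K_card size_polyDl // size_polyXn.
move=> _ /mapP[t + ->]; rewrite mem_enum => tK; split.
  rewrite rootE rmorphB rmorphD rmorphM /= map_polyXn !map_polyC map_polyX.
  rewrite !hornerE /= phiX phiA x'i0 -{1}[q]expn1 (exprDq pchar_mpoly) expn1.
  have qE (B : comNzRingType) (z : B) : z ^+ q = z ^+ q.-1 * z.
    by rewrite -exprSr prednK // ltnW.
  rewrite !exprZn exprMn K_exp // -!mul_mpolyC !qE !mpolyCM.
  by apply/eqP; ring.
rewrite -[RHS](hinv _ (W_scale tK wW)) -EQ -horner_map /= ytw // -map_poly_comp.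
congr _.[_]; apply: eq_map_poly => p /=.
by rewrite phiE comp_mpoly_fixed // => j; apply: x'tw.
Qed.

(** The last two clauses measure progress: [w] is now killed by all c_j, and vectors killed before
    remain so. The induction in [tower_top] counts the vectors not yet killed. *)
Lemma tower_step x d c M w : tower x d c M -> w \in W -> (exists j, c j w != 0) ->
  exists x' d' c' M', [/\ tower x' d' c' M', forall j, c' j w = 0 &
    forall b, b \in W -> (forall j, c j b = 0) -> forall j, c' j b = 0].
Proof.
move=> T wW [j0 cj0].
case: (arg_minnP (P := fun j => c j w != 0) d cj0) => i0 C0 Dmin {j0 cj0}.
have [xm dm cm Mm] := tower_max T.
have i0m : i0 != ord_max by apply: contraNneq C0 => ->; rewrite cm.
have mi0 : (ord_max == i0) = false by rewrite eq_sym (negbTE i0m).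
pose C := c i0 w; pose D := d i0; pose y := x i0; pose L := l ^+ (q ^ D).
(* The factor [kap j] makes the new c_j vanish at [w]. Truncation in the exponent is harmless: if
   [d j < D], minimality of [D] gives c_j(w) = 0, so [kap j = 0]. *)
pose m j := (q ^ (d j - D))%N.
pose kap j := c j w / C ^+ m j.
have kapP j : kap j = 0 \/ (D <= d j)%N.
  have [cj|/Dmin] := eqVneq (c j w) 0; last by right.
  by left; rewrite /kap cj mul0r.
(* The value at [i0] is the product of the translates y + t C L over t in [K], since the elements of
   [K] are the roots of X^q - X. *)
pose x' j := if j == i0 then y ^+ q - (C *: L) ^+ q.-1 * y else x j - kap j *: y ^+ m j.
pose d' j := if j == i0 then D.+1 else d j.
pose c' j b := if j == i0 then c i0 b ^+ q - C ^+ q.-1 * c i0 b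
               else c j b - kap j * c i0 b ^+ m j.
(* For [d j > D] the subtracted power of [y] has an exponent divisible by q, hence differential 0,
   and u_j does not change. *)
pose k' j := if d j == D then kap j else 0.
pose M' : 'M[F]_n.+1 := \matrix_j
  if j == i0 then (- C ^+ q.-1) *: row i0 M else row j M - k' j *: row i0 M.
have kapm : kap ord_max = 0 by rewrite /kap cm // mul0r.
have x'm : x' ord_max = l by rewrite /x' mi0 kapm scale0r subr0.
have qE (B : comNzRingType) (z : B) : z ^+ q = z ^+ q.-1 * z.
  by rewrite -exprSr prednK // ltnW.
have scal j t b : t \in K -> b \in W -> c' j (t *: b) = t * c' j b.
  move=> tK bW; rewrite /c' !(tower_scale T) // !exprMn K_exp // K_exp_iter //.
  by case: ifP => _; ring.
have wz j : c' j w = 0.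
  rewrite /c' /kap; case: eqP => _; first by rewrite -/C qE subrr.
  by rewrite -/C divfK ?subrr // expf_neq0.
have shr j b : b \in W -> msubst (shear b) (x' j) = x' j + c' j b *: l ^+ (q ^ d' j).
  move=> bW; rewrite /x' /c' /d'; case: eqP => [_|_].
    rewrite rmorphB rmorphM !rmorphXn /= msubstZ rmorphXn /= shear_wall //.
    rewrite (tower_shear T) // -/y -/D -/L -{1}[q]expn1 (exprDq pchar_mpoly) expn1.
    rewrite expnSr exprM -/L (qE _ L) !exprZn -!mul_mpolyC mpolyCB mpolyCM (qE _ L).
    by ring.
  rewrite rmorphB /= msubstZ rmorphXn /= !(tower_shear T) // -/y -/D.
  case: (kapP j) => [->|Dj]; first by rewrite !scale0r mul0r !subr0.
  rewrite /m (exprDq pchar_mpoly) exprZn -exprM -expnD subnKC //.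
  by rewrite -!mul_mpolyC mpolyCB [(kap j * _)%:MP]mpolyCM; ring.
have tw t j : t \in K -> msubst (shear (t *: w)) (x' j) = x' j.
  by move=> tK; rewrite shr ?W_scale // scal // wz mulr0 scale0r addr0.
exists x', d', c', M'; split => //; last first.
  move=> b bW cb j; rewrite /c' !cb; case: ifP => _.
    by rewrite qE !mulr0 subrr.
  by rewrite expr0n gtn_eqF ?mulr0 ?subr0 // expn_gt0 ltnW.
split => //.
- split=> //; first by rewrite /d' mi0.
    by move=> b bW; rewrite /c' mi0 kapm mul0r subr0 cm.
  by rewrite rowK mi0 /k' kapm if_same scale0r subr0.
- rewrite -row_full_unit -col_leq_rank; apply: leq_trans (mxrankS (_ : M <= M')%MS).
    by rewrite col_leq_rank row_full_unit (tower_unit T).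
  have i0M' : (row i0 M <= M')%MS.
    have a0 : - C ^+ q.-1 != 0 by rewrite oppr_eq0 expf_neq0.
    rewrite -(scalerK a0 (row i0 M)) scalemx_sub //.
    by have := row_sub i0 M'; rewrite rowK eqxx.
  apply/row_subP => j; case: (eqVneq j i0) => [-> //|ji].
  rewrite -(subrK (k' j *: row i0 M) (row j M)) addmx_sub ?scalemx_sub //.
  by have := row_sub j M'; rewrite rowK (negbTE ji).
- move=> j jm; have Mi := tower_col T i0m; have Mj := tower_col T jm.
  by rewrite mxE; case: ifP => _; rewrite !mxE Mi ?Mj mulr0 ?subr0.
- move=> j; rewrite /x' /d'; have yh : y \is (q ^ D).-homog by exact: tower_homog T i0.
  have Lh : L \is (q ^ D).-homog.
    by rewrite -[(q ^ D)%N]mul1n dhomogMn // dhomogX; apply/eqP/mdeg1.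
  case: eqP => _.
    rewrite dhomogD ?dhomogN //; first by rewrite expnSr dhomogMn.
    rewrite exprZn -scalerAl dhomogZ //.
    have -> : (q ^ D.+1 = q ^ D * q.-1 + q ^ D)%N by rewrite -mulnSr prednK ?expnSr // ltnW.
    by rewrite dhomogM // dhomogMn.
  case: (kapP j) => [->|Dj]; first by rewrite scale0r subr0 (tower_homog T).
  rewrite dhomogD ?dhomogN ?(tower_homog T) // dhomogZ //.
  by rewrite -(subnKC Dj) expnD dhomogMn.
- move=> j jm; rewrite /x'; have yd : msubst (dilation n mu) y = y by exact: tower_dil T _ i0m.
  case: eqP => _.
    rewrite rmorphB rmorphM !rmorphXn /= msubstZ rmorphXn /= yd msubst_dilationX eqxx.
    rewrite !exprZn -/L; congr (_ - _ *: _ * _).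
    (* The dilation fixes [L ^+ q.-1] because mu^(q-1) = 1. *)
    by rewrite -exprM mulnC exprM mu_exp expr1n scale1r.
  by rewrite rmorphB /= msubstZ rmorphXn /= yd (tower_dil T).
- move=> j; rewrite /x' /d' rowK; case: eqP => _.
    by apply: differential_shape_artin_schreier; [exact: C0|exact: tower_diff T i0].
  have Tj := tower_diff T j; case: (kapP j) => [k0|Dj].
    by rewrite /k' k0 if_same !scale0r !subr0.
  rewrite /k'; case: eqP => [dj|/eqP dj].
    rewrite dj in Tj; rewrite /m dj subnn expn0 expr1.
    exact: differential_shape_sub Tj (tower_diff T i0).
  rewrite scale0r subr0; move: Tj; rewrite /differential_shape.
  have Dlt : (D < d j)%N by rewrite ltn_neqAle eq_sym dj.
  rewrite gtn_eqF ?(leq_ltn_trans _ Dlt) // dfrmB dfrmZ dfrm_exp => ->.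
  by rewrite -mulr_natr q_natr0 ?subn_gt0 // mulr0 scale0r scaler0 subr0.
- move=> h hinv.
  apply: (@descent_step x x' i0 w C D kap m) => //.
  + by move=> t tK; rewrite (tower_shear T) ?W_scale // (tower_scale T).
  + by rewrite /x' eqxx.
  + by move=> j /negbTE ji; rewrite /x' ji.
  + exact: tower_gen T _ hinv.
Qed.

Lemma tower_top : exists x d c M, tower x d c M /\ forall j b, b \in W -> c j b = 0.
Proof.
suff H (a : nat) : forall x d c M, tower x d c M ->
    (#|[set b in W | [exists j, c j b != 0%R]]| < a)%N ->
    exists x d c M, tower x d c M /\ forall j b, b \in W -> c j b = 0.
  by apply: (H _ _ _ _ _ tower_start (ltnSn _)).
elim: a => // a IH x d c M T; rewrite ltnS => sa.
have [w /setIdP[wW /existsP cw]|E] := pickP (mem [set b in W | [exists j, c j b != 0]]).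
  have [x' [d' [c' [M' [T' wz mon]]]]] := tower_step T wW cw.
  apply: IH T' _; apply: leq_trans sa; apply: proper_card; apply/properP; split.
    apply/subsetP => b; rewrite !inE => /andP[bW]; rewrite bW /=.
    apply: contraLR; rewrite !negb_exists => /forallP cb.
    apply/forallP => j; rewrite negbK mon // => i.
    by apply/eqP; have := cb i; rewrite negbK.
  exists w; first by rewrite inE wW; apply/existsP.
  by rewrite inE wW; apply/existsP => -[j]; rewrite wz eqxx.
exists x, d, c, M; split => // j b bW; apply/eqP.
by have := E b; rewrite /= inE bW => /negbT; rewrite negb_exists => /forallP/(_ j); rewrite negbK.
Qed.

End Tower.

(** * Forms written in the basis du_1, ..., du_n *)

Section NormalForm.
Variables (F : finFieldType) (n : nat).
Notation mp := {mpoly F[n.+1]}.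
Notation l := ('X_(@ord_max n) : mp).
Implicit Types (h : mp) (om : oneform F n.+1) (r b : 'rV[F]_n.+1).

Lemma dfrm_linform r : dfrm (linform r) = map_mx (@mpolyC n.+1 F) r.
Proof.
apply/rowP => i; rewrite mxE mxE raddf_sum (bigD1 i) //= big1 ?addr0 => [|k ki].
  by rewrite mderivZ mderivXU eqxx alg_mpolyC.
by rewrite mderivZ mderivXU (negbTE ki) scaler0.
Qed.

Lemma msubst_shear_linform b r :
  msubst (shear b) (linform r) = linform r + (\sum_k r 0 k * b 0 k) *: l.
Proof.
rewrite rmorph_sum scaler_suml -big_split; apply: eq_bigr => k _ /=.
by rewrite msubstZ msubst_shearX scalerDr scalerA.
Qed.

Lemma msubst_dilation_linform mu r : r 0 ord_max = 0 ->
  msubst (dilation n mu) (linform r) = linform r.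
Proof.
move=> r0; rewrite rmorph_sum; apply: eq_bigr => k _ /=.
rewrite msubstZ msubst_dilationX; case: eqP => [->|_]; last by rewrite scale1r.
by rewrite r0 !scale0r.
Qed.

Section Basis.
Variable M : 'M[F]_n.+1.
Hypotheses (Mu : M \in unitmx).
Let u j := linform (row j M).

Lemma linform_basis_sum (h : 'I_n.+1 -> mp) :
  \sum_j h j *: dfrm (u j) = (\row_j h j) *m map_mx (@mpolyC n.+1 F) M.
Proof.
rewrite mulmx_sum_row; apply: eq_bigr => j _.
by rewrite dfrm_linform map_row mxE.
Qed.

Lemma linform_basis_inj (h k : 'I_n.+1 -> mp) :
  \sum_j h j *: dfrm (u j) = \sum_j k j *: dfrm (u j) -> h =1 k.
Proof.
rewrite !linform_basis_sum => E j.
have := congr1 (fun v => (v *m map_mx (@mpolyC n.+1 F) (invmx M)) 0 j) E.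
by rewrite -!mulmxA -map_mxM mulmxV // map_mx1 !mulmx1 !mxE.
Qed.

Lemma linform_basis_span om : exists h : 'I_n.+1 -> mp, om = \sum_j h j *: dfrm (u j).
Proof.
exists (fun j => (om *m map_mx (@mpolyC n.+1 F) (invmx M)) 0 j).
rewrite linform_basis_sum.
have -> : \row_j (om *m map_mx (@mpolyC n.+1 F) (invmx M)) 0 j =
          om *m map_mx (@mpolyC n.+1 F) (invmx M) by apply/rowP => j; rewrite mxE.
by rewrite -mulmxA -map_mxM mulVmx // map_mx1 mulmx1.
Qed.

Lemma sum_triangular (c A B : 'I_n.+1 -> mp) (m : 'I_n.+1) :
  \sum_j c j *: (A j *: dfrm (u j) + B j *: dfrm (u m)) =
  \sum_j (c j * A j + (if j == m then \sum_k c k * B k else 0)) *: dfrm (u j).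
Proof.
transitivity (\sum_j (c j * A j) *: dfrm (u j) + (\sum_k c k * B k) *: dfrm (u m)).
  rewrite scaler_suml -big_split; apply: eq_bigr => j _ /=.
  by rewrite scalerDr !scalerA.
rewrite (bigD1 m) // [RHS](bigD1 m) //= eqxx [in RHS]scalerDl -!addrA; congr (_ + _).
rewrite addrC; congr (_ + _); apply: eq_bigr => j /negbTE->.
by rewrite addr0.
Qed.

(** Off the diagonal only column [m] is occupied, so the coefficients with j different from m vanish
    first, and then the one at [m]. *)
Lemma triangular_free (th : 'I_n.+1 -> oneform F n.+1) (c A B : 'I_n.+1 -> mp) m :
  (forall j, A j != 0) -> B m = 0 ->
  (forall j, th j = A j *: dfrm (u j) + B j *: dfrm (u m)) ->
  \sum_j c j *: th j = 0 -> forall j, c j = 0.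
Proof.
move=> A0 Bm thE; under eq_bigr => j _ do rewrite thE.
rewrite sum_triangular => E0.
have E := linform_basis_inj (h := fun j => c j * A j + (if j == m then \sum_k c k * B k else 0))
  (k := fun=> 0) _.
have {E0}E j : c j * A j + (if j == m then \sum_k c k * B k else 0) = 0.
  by apply: E; rewrite E0 big1 // => k _; rewrite scale0r.
have cj j : j != m -> c j = 0.
  move=> /negbTE jm; have /eqP := E j; rewrite jm addr0 mulf_eq0 (negbTE (A0 j)) orbF.
  by move/eqP.
move=> j; have [->|/cj //] := eqVneq j m.
have /eqP := E m; rewrite eqxx big1 ?addr0 => [|k _].
  by rewrite mulf_eq0 (negbTE (A0 m)) orbF => /eqP.
by have [->|/cj ->] := eqVneq k m; rewrite ?Bm ?mulr0 ?mul0r.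
Qed.

End Basis.
End NormalForm.

(** * Basic invariants and generators of the invariant forms, in adapted coordinates *)

Section BasicInvariants.
Variables (F : finFieldType) (n : nat).
Notation mp := {mpoly F[n.+1]}.
Notation l := ('X_(@ord_max n) : mp).
Variables (W : {set 'rV[F]_n.+1}) (K : {set F}) (q ch e : nat) (mu : F).
Hypotheses (chF : ch \in [pchar F]) (q_ch : ch.-nat q) (q_gt1 : (1 < q)%N).
Hypothesis W_max : forall b, b \in W -> b 0 ord_max = 0.
Hypotheses (mu_exp : mu ^+ q.-1 = 1) (mu_prim : e.-primitive_root mu).
Variables (x : 'I_n.+1 -> mp) (d : 'I_n.+1 -> nat)
  (c : 'I_n.+1 -> 'rV[F]_n.+1 -> F) (M : 'M[F]_n.+1).
Hypothesis (T : tower W K q mu x d c M) (c0 : forall j b, b \in W -> c j b = 0).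
Implicit Types (h : mp) (om : oneform F n.+1) (b : 'rV[F]_n.+1).

Let u j := linform (row j M).
Let Mu : M \in unitmx := tower_unit T.

(** The shears in [W] and this dilation will generate the conjugated group, so this is invariance
    under G in the new coordinates. *)
Definition wall_invariant h := shear_invariant W h /\ msubst (dilation n mu) h = h.

Definition wall_form_invariant om :=
  (forall b, b \in W -> fsubst (shear b) om = om) /\ fsubst (dilation n mu) om = om.

Lemma wall_invariantB g h : wall_invariant g -> wall_invariant h -> wall_invariant (g - h).
Proof.
by move=> [gW gd] [hW hd]; split=> [b bW|]; rewrite rmorphB /= ?gW ?hW // gd hd.
Qed.

Lemma wall_form_invariant_dfrm h : wall_invariant h -> wall_form_invariant (dfrm h).
Proof. by move=> [hW hd]; split=> [b bW|]; rewrite -dfrm_msubst ?hW ?hd. Qed.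

Lemma wall_form_invariantB om om' :
  wall_form_invariant om -> wall_form_invariant om' -> wall_form_invariant (om - om').
Proof.
by move=> [W1 d1] [W2 d2]; split=> [b bW|]; rewrite fsubstD fsubstN ?W1 ?W2 // d1 d2.
Qed.

Lemma wall_form_invariantZ h om :
  wall_invariant h -> wall_form_invariant om -> wall_form_invariant (h *: om).
Proof. by move=> [hW hd] [W1 d1]; split=> [b bW|]; rewrite fsubstZ ?hW ?W1 // hd d1. Qed.

Lemma wall_form_invariant_sum (I : Type) (r : seq I) (P : pred I) (w : I -> oneform F n.+1) :
  (forall i, P i -> wall_form_invariant (w i)) ->
  wall_form_invariant (\sum_(i <- r | P i) w i).
Proof.
move=> wi; split=> [b bW|]; rewrite fsubst_sum; apply: eq_bigr => i Pi.
  by have [-> //] := wi i Pi.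
by have [_ ->] := wi i Pi.
Qed.

Let l_neq0 : l != 0 := @mpolyX_neq0 F n ord_max.

Lemma e_gt0 : (0 < e)%N. Proof. exact: prim_order_gt0 mu_prim. Qed.

Lemma e_dvd k : (e %| (q ^ k).-1)%N.
Proof.
apply: dvdn_trans (dvdn_pred_predX q k).
by rewrite (prim_order_dvd mu_prim) mu_exp.
Qed.

(** [e] divides q - 1, which is -1 in F. Hence d(l^e) is nonzero and one may divide by [e]. *)
Lemma e_natr_neq0 : e%:R != 0 :> F.
Proof.
have /dvdnP[k qk] := e_dvd 1; apply/eqP => e0.
have q0 : q%:R = 0 :> F.
  move: (q_natr0 n chF q_ch q_gt1 (isT : (0 < 1)%N)); rewrite expn1 -mpolyC_nat => /eqP.
  by rewrite mpolyC_eq0 => /eqP.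
have /eqP := congr1 (fun m => m.+1%:R : F) qk.
by rewrite expn1 prednK ?(ltnW q_gt1) // q0 -natr1 natrM e0 mulr0 add0r eq_sym oner_eq0.
Qed.

Lemma linform_last_row : u ord_max = l.
Proof. by rewrite /u; have [_ _ _ ->] := tower_max T; rewrite linform_delta. Qed.

Lemma dilation_u j : j != ord_max -> msubst (dilation n mu) (u j) = u j.
Proof. by move=> jm; rewrite msubst_dilation_linform // mxE (tower_col T). Qed.

Lemma dilation_wall : msubst (dilation n mu) l = mu *: l.
Proof. by rewrite msubst_dilationX eqxx. Qed.

Lemma x_wall_invariant j : j != ord_max -> wall_invariant (x j).
Proof.
move=> jm; split=> [b bW|]; last exact: tower_dil T _ jm.
by rewrite (tower_shear T) // c0 // scale0r addr0.
Qed.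

Definition wall_power : mp := l ^+ e.

Lemma wall_power_invariant : wall_invariant wall_power.
Proof.
split=> [b bW|]; rewrite rmorphXn /=; first by rewrite (shear_wall W_max).
by rewrite dilation_wall exprZn (prim_expr_order mu_prim) scale1r.
Qed.

(** Chosen so that e a_j + (e - 1) = q^(d_j) - 2: this removes from dx_j every factor of l beyond
    the l^(e-1) kept in [basic_form]. *)
Definition wall_quotient_exp j :=
  if (j == ord_max) || (d j == 0%N) then 0%N else ((q ^ d j).-1 %/ e).-1.

Definition basic_inv j : mp := if j == ord_max then wall_power else x j.

(** Formally l^2 d(u_j / l). A shear adds a constant to u_j / l, so it fixes this form; for j < n
    the dilation multiplies the form by [mu]. *)
Definition koszul j : oneform F n.+1 := l *: dfrm (u j) - u j *: dfrm l.

(** The factor l^(e-1) raises the weight [mu] of [koszul j] to mu^e = 1. *)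
Definition basic_form j : oneform F n.+1 :=
  if (j == ord_max) || (d j == 0%N) then dfrm (basic_inv j)
  else l ^+ e.-1 *: koszul j.

Lemma basic_inv_invariant j : wall_invariant (basic_inv j).
Proof.
rewrite /basic_inv; case: (eqVneq j ord_max) => [_|]; first exact: wall_power_invariant.
exact: x_wall_invariant.
Qed.

Lemma basic_inv_homog j : exists k, basic_inv j \is k.-homog.
Proof.
rewrite /basic_inv; case: eqP => _; last by exists (q ^ d j)%N; apply: tower_homog T j.
by exists (1 * e)%N; rewrite dhomogMn // dhomogX; apply/eqP/mdeg1.
Qed.

Lemma dfrm_basic_inv j : dfrm (basic_inv j) = l ^+ (e * wall_quotient_exp j) *: basic_form j.
Proof.
rewrite /basic_form /wall_quotient_exp; case: ifP => [_|].
  by rewrite muln0 expr0 scale1r.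
move=> /norP[jm dj]; rewrite scalerA -exprD /basic_inv (negbTE jm).
have := tower_diff T j; rewrite /differential_shape (negbTE dj) => ->.
congr (_ ^+ _ *: _); have /dvdnP[k qk] := e_dvd (d j).
have Q2 : (2 <= q ^ d j)%N by rewrite (leq_trans q_gt1) // -{1}(expn1 q) leq_exp2l // lt0n.
rewrite qk mulnK ?e_gt0 // subn2 qk; case: k qk => [|k _] /=.
  by case: (q ^ d j)%N Q2 => [|[|]].
by rewrite mulSn mulnC addnC; case: e e_gt0 => // a _; rewrite addnS.
Qed.

Lemma koszul_row_shear (R : comNzRingType) m (L f a : R) (X Z : 'rV[R]_m) :
  L *: (X + a *: Z) - (f + a * L) *: Z = L *: X - f *: Z.
Proof. by apply/rowP => i; rewrite !mxE; ring. Qed.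

Lemma koszul_row_split (R : comNzRingType) m k (L f C : R) (X Z : 'rV[R]_m) :
  (L * (L ^+ k * C)) *: X = C *: (L ^+ k *: (L *: X - f *: Z)) + (C * L ^+ k * f) *: Z.
Proof. by apply/rowP => i; rewrite !mxE; ring. Qed.

Lemma koszul_shear b j : b \in W -> fsubst (shear b) (koszul j) = koszul j.
Proof.
move=> bW; rewrite /koszul fsubstD fsubstN 2!fsubstZ -2!dfrm_msubst (shear_wall W_max bW).
rewrite msubst_shear_linform dfrmD dfrmZ -mul_mpolyC; exact: koszul_row_shear.
Qed.

Lemma koszul_dilation j : j != ord_max -> fsubst (dilation n mu) (koszul j) = mu%:MP *: koszul j.
Proof.
move=> jm; rewrite /koszul fsubstD fsubstN 2!fsubstZ -2!dfrm_msubst (dilation_u jm).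
rewrite dilation_wall dfrmZ -mul_mpolyC scalerBr 3!scalerA.
by congr (_ - _ *: _); rewrite mulrC.
Qed.

Lemma basic_form_invariant j : wall_form_invariant (basic_form j).
Proof.
rewrite /basic_form; case: ifP => [_|/norP[jm dj]].
  exact/wall_form_invariant_dfrm/basic_inv_invariant.
split=> [b bW|]; rewrite fsubstZ rmorphXn /=.
  by rewrite (shear_wall W_max bW) (koszul_shear _ bW).
rewrite dilation_wall (koszul_dilation jm) exprZn -mul_mpolyC scalerA mulrAC -mpolyCM.
by rewrite -exprSr (prednK e_gt0) (prim_expr_order mu_prim) mpolyC1 mul1r.
Qed.

Lemma dfrm_wall_power : dfrm wall_power = (e%:R%:MP * l ^+ e.-1) *: dfrm l.
Proof. by rewrite /wall_power dfrm_exp -mulr_natr mulrC -mpolyC_nat. Qed.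

(* The last coefficient is a parameter because x_n = l and l^e differ there only. *)
Definition diff_coef k j : mp :=
  if j == ord_max then k else if d j == 0%N then 1 else l ^+ (q ^ d j - 2) * l.

Definition wall_coef j : mp :=
  if (j == ord_max) || (d j == 0%N) then 0 else - (l ^+ (q ^ d j - 2) * u j).

Lemma dfrm_x j : dfrm (x j) = diff_coef 1 j *: dfrm (u j) + wall_coef j *: dfrm l.
Proof.
rewrite /diff_coef /wall_coef; have [->|jm] /= := eqVneq j ord_max.
  by have [-> _ _ _] := tower_max T; rewrite linform_last_row scale1r scale0r addr0.
have := tower_diff T j; rewrite /differential_shape; case: ifP => [_ ->|_ ->].
  by rewrite scale1r scale0r addr0.
by rewrite scalerBr 2!scalerA scaleNr.
Qed.

Lemma diff_coef_neq0 k j : k != 0 -> diff_coef k j != 0.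
Proof.
move=> k0; rewrite /diff_coef; case: ifP => // _; case: ifP => _; first exact: oner_neq0.
by rewrite mulf_neq0 // expf_neq0.
Qed.

(** The dx_j are triangular in the du_j with nonzero diagonal, so the Jacobian criterion applies. *)
Lemma x_alg_indep p : p \mPo [tuple x i | i < n.+1] = 0 -> p = 0.
Proof.
apply: dfrm_alg_indep => cf E.
apply: (triangular_free Mu (th := fun j => dfrm (x j)) (A := diff_coef 1) (B := wall_coef)
  (m := ord_max)).
- by move=> j; apply/diff_coef_neq0/oner_neq0.
- by rewrite /wall_coef eqxx.
- by move=> j; rewrite -/(u ord_max) linform_last_row; apply: dfrm_x.
- by rewrite -[RHS]E; apply: eq_bigr => j _; rewrite tnth_mktuple.
Qed.

Lemma basic_inv_alg_indep p : p \mPo [tuple basic_inv i | i < n.+1] = 0 -> p = 0.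
Proof.
apply: dfrm_alg_indep => cf E.
have el0 : e%:R%:MP * l ^+ e.-1 != 0 :> mp.
  by rewrite mulf_neq0 ?expf_neq0 // mpolyC_eq0 e_natr_neq0.
apply: (triangular_free Mu (th := fun j => dfrm (basic_inv j))
  (A := diff_coef (e%:R%:MP * l ^+ e.-1)) (B := wall_coef) (m := ord_max)).
- by move=> j; apply: diff_coef_neq0.
- by rewrite /wall_coef eqxx.
- move=> j; rewrite -/(u ord_max) linform_last_row /basic_inv; case: (eqVneq j ord_max) => [->|jm].
    by rewrite /diff_coef /wall_coef eqxx scale0r addr0 -/(u ord_max) linform_last_row dfrm_wall_power.
  by rewrite dfrm_x /diff_coef (negbTE jm).
- by rewrite -[RHS]E; apply: eq_bigr => j _; rewrite tnth_mktuple.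
Qed.

Lemma dilation_comp (p : mp) : msubst (dilation n mu) (p \mPo [tuple x i | i < n.+1]) =
  msubst (dilation n mu) p \mPo [tuple x i | i < n.+1].
Proof.
have Li i : tnth (lin_subst (dilation n mu)) i = (if i == ord_max then mu else 1) *: 'X_i.
  by rewrite -comp_mpoly_tnth; apply: msubst_dilationX.
rewrite /msubst 2!comp_mpolyA; apply: eq_comp_mpoly => i.
rewrite [LHS]tnth_mktuple [RHS]tnth_mktuple Li tnth_mktuple.
rewrite -[LHS]/(msubst (dilation n mu) (x i)).
rewrite comp_mpolyZ comp_mpoly_tnth tnth_mktuple.
have [->|im] := eqVneq i ord_max; last by rewrite (tower_dil T) // scale1r.
by have [-> _ _ _] := tower_max T; rewrite dilation_wall.
Qed.

(** Write h = Q(x). The dilation scales only x_n = l, so algebraic independence of the x_j carries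
    the invariance over to [Q], which is then a polynomial in the e-th power of its last
    variable. *)
Lemma basic_inv_generate h : wall_invariant h ->
  exists p, h = p \mPo [tuple basic_inv i | i < n.+1].
Proof.
move=> [hW hd]; have [Q hQ] := tower_gen T hW.
have Qd : msubst (dilation n mu) Q = Q.
  apply/eqP; rewrite -subr_eq0; apply/eqP/x_alg_indep.
  by rewrite comp_mpolyB -dilation_comp -hQ hd subrr.
have [p pQ] := dilation_invariant mu_prim Qd; exists p.
have [xm _ _ _] := tower_max T.
rewrite hQ pQ comp_mpolyA; apply: eq_comp_mpoly => i; rewrite 3!tnth_mktuple.
have [->|im] := eqVneq i ord_max.
  by rewrite rmorphXn /= comp_mpoly_tnth tnth_mktuple xm /basic_inv eqxx.
by rewrite comp_mpoly_tnth tnth_mktuple /basic_inv (negbTE im).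
Qed.

Let shift b j : F := \sum_k row j M 0 k * b 0 k.

Lemma shear_u b j : msubst (shear b) (u j) = u j + shift b j *: l.
Proof. exact: msubst_shear_linform. Qed.

(** If [d j = 0] then x_j = u_j, and x_j is invariant under [W] because all c_j vanish. *)
Lemma shift_eq0 b j : b \in W -> d j = 0%N -> shift b j = 0.
Proof.
move=> bW dj; have := tower_diff T j; rewrite /differential_shape dj eqxx -/(u j) => xu.
have := tower_shear T j bW; rewrite c0 // scale0r addr0 xu shear_u.
move/eqP; rewrite -subr_eq0 addrC addKr scaler_eq0 (negbTE l_neq0) orbF => /eqP //.
Qed.

(** A shear changes du_j only by a multiple of du_n = dl, so all coefficients but the last are fixed
    and the last absorbs the rest. *)
Lemma shear_coefs (h : 'I_n.+1 -> mp) b : b \in W ->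
  wall_form_invariant (\sum_j h j *: dfrm (u j)) -> forall j,
  h j = msubst (shear b) (h j) +
        (if j == ord_max then \sum_k msubst (shear b) (h k) * (shift b k)%:MP else 0).
Proof.
move=> bW [/(_ b bW) E _] j.
pose g i := msubst (shear b) (h i).
apply: (linform_basis_inj Mu (h := h) (k := fun j => g j +
  (if j == ord_max then \sum_k g k * (shift b k)%:MP else 0))).
rewrite -[LHS]E fsubst_sum.
transitivity (\sum_j g j *: (1 *: dfrm (u j) + (shift b j)%:MP *: dfrm (u ord_max))).
  apply: eq_bigr => i _; rewrite fsubstZ -dfrm_msubst shear_u dfrmD dfrmZ scale1r.
  by rewrite linform_last_row.
by rewrite sum_triangular; apply: eq_bigr => i _; rewrite mulr1.
Qed.

Lemma dilation_coefs (h : 'I_n.+1 -> mp) :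
  wall_form_invariant (\sum_j h j *: dfrm (u j)) ->
  forall j, j != ord_max -> msubst (dilation n mu) (h j) = h j.
Proof.
move=> [_ E] j jm.
have H := linform_basis_inj Mu (h := h) (k := fun i => msubst (dilation n mu) (h i) *
  (if i == ord_max then mu%:MP else 1)) _.
rewrite [RHS]H ?(negbTE jm) ?mulr1 // -[LHS]E fsubst_sum; apply: eq_bigr => i _.
rewrite fsubstZ -dfrm_msubst -scalerA; congr (_ *: _); rewrite -/(u i).
have [->|im] := eqVneq i ord_max; first by rewrite linform_last_row dilation_wall dfrmZ.
by rewrite dilation_u // scale1r.
Qed.

Lemma at_wall_shear b h : at_wall (msubst (shear b) h) = at_wall h.
Proof. by have [g ->] := shear_split b h; rewrite rmorphD /= at_wall_mull addr0. Qed.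

(* On the wall, the coefficient vectors of an invariant form pair to 0 with the shifts,
   so they define an invariant linear form; its differential involves u_j only
   through multiples of l. *)
Lemma at_wall_coef (h : 'I_n.+1 -> mp) : wall_form_invariant (\sum_j h j *: dfrm (u j)) ->
  forall j, d j != 0%N -> at_wall (h j) = 0.
Proof.
move=> hinv j dj; apply/mpolyP => m; rewrite mcoeff0.
(* Taking the coefficients at one monomial [m] gives scalars, so that [v] is a linear form. Those
   with [d i = 0] may be dropped since their shifts vanish. *)
pose a i := if d i == 0%N then 0 else (at_wall (h i))@_m.
pose v := \sum_i a i *: u i.
have av b : b \in W -> \sum_i a i * shift b i = 0.
  move=> bW; transitivity (\sum_i (at_wall (h i))@_m * shift b i).
    apply: eq_bigr => i _; rewrite /a; case: eqP => // di.
    by rewrite shift_eq0 // !mulr0.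
  have := shear_coefs bW hinv ord_max; rewrite eqxx.
  have [g ->] := shear_split b (h ord_max).
  move/eqP; rewrite -addrA -subr_eq0 opprD addrA subrr sub0r oppr_eq0 => /eqP.
  move/(congr1 (@at_wall F n)); rewrite rmorphD /= at_wall_mull add0r rmorph_sum rmorph0 /=.
  move/(congr1 (mcoeff m)); rewrite mcoeff0 => E0; rewrite -[RHS]E0 raddf_sum; apply: eq_bigr => i _ /=.
  rewrite rmorphM /= at_wall_shear [at_wall _%:MP]comp_mpolyC.
  by rewrite [at_wall _ * _]mulrC mul_mpolyC mcoeffZ mulrC.
have vW : shear_invariant W v.
  move=> b bW; rewrite rmorph_sum /=.
  under eq_bigr => i _ do rewrite msubstZ shear_u scalerDr scalerA.
  by rewrite big_split /= -scaler_suml av // scale0r addr0.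
have [Q vQ] := tower_gen T vW.
pose y i := mderiv i Q \mPo [tuple x i | i < n.+1].
(* Compare the coefficients of du_i in dv, computed from the definition of [v] and from v = Q(x). *)
have E i : i != ord_max -> (a i)%:MP = y i * diff_coef 1 i.
  move=> im; have H := linform_basis_inj Mu (h := fun i => (a i)%:MP) (k := fun j =>
    y j * diff_coef 1 j + (if j == ord_max then \sum_k y k * wall_coef k else 0)) _.
  rewrite [LHS]H ?(negbTE im) ?addr0 // -sum_triangular.
  transitivity (dfrm v).
    rewrite /v; elim/big_rec2: _ => [|k ? ? _ ->]; first by rewrite -mpolyC0 dfrmC.
    by rewrite dfrmD dfrmZ.
  rewrite vQ dfrm_comp; apply: eq_bigr => k _.
  by rewrite tnth_mktuple dfrm_x -/(u ord_max) linform_last_row.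
have jm : j != ord_max.
  by apply: contraNneq dj => ->; have [_ -> _ _] := tower_max T.
have /(congr1 (@at_wall F n)) := E j jm.
rewrite /diff_coef (negbTE jm) (negbTE dj) /a (negbTE dj) mulrA mulrC at_wall_mull.
by rewrite [at_wall _%:MP]comp_mpolyC => /eqP; rewrite mpolyC_eq0 => /eqP.
Qed.

(** The weight of [h] under the dilation is the inverse of [mu], that is mu^(e-1). *)
Lemma semi_invariant_wall_div h : shear_invariant W h ->
  mu *: msubst (dilation n mu) h = h ->
  exists2 g, wall_invariant g & h = l ^+ e.-1 * g.
Proof.
move=> hW hd.
have hd' : msubst (dilation n mu) h = mu ^+ e.-1 *: h.
  rewrite -{2}hd scalerA -exprSr (prednK e_gt0) (prim_expr_order mu_prim).
  by rewrite scale1r.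
have lt_e : (e.-1 < e)%N by rewrite prednK ?e_gt0.
have [g hg gd] := dilation_semi_invariant mu_prim lt_e hd'.
exists g => //; split=> // b bW; apply: (mulfI (expf_neq0 e.-1 l_neq0)).
by have := hW b bW; rewrite hg rmorphM rmorphXn /= (shear_wall W_max).
Qed.

(** If [d j > 0], then h_j = l g where g has weight inverse to [mu], so h_j = l^e C. Then l^e C du_j
    is C times the basic form plus C l^(e-1) u_j dl. *)
Lemma coef_decomposition (h : 'I_n.+1 -> mp) :
  wall_form_invariant (\sum_j h j *: dfrm (u j)) ->
  forall j, exists CH : mp * mp, wall_invariant CH.1 /\
    h j *: dfrm (u j) = CH.1 *: basic_form j + CH.2 *: dfrm l.
Proof.
move=> hinv j; have [->|jm] := eqVneq j ord_max.
  exists (0, h ord_max); split; last by rewrite scale0r add0r linform_last_row.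
  by split=> [b bW|]; rewrite rmorph0.
have hW : shear_invariant W (h j).
  move=> b bW; have := shear_coefs bW hinv j.
  by rewrite (negbTE jm) addr0 => <-.
have hd := dilation_coefs hinv jm.
have [dj|dj] := eqVneq (d j) 0%N.
  exists (h j, 0); split=> //=; rewrite scale0r addr0 /basic_form dj eqxx orbT.
  rewrite /basic_inv (negbTE jm).
  by have := tower_diff T j; rewrite /differential_shape dj eqxx => ->.
have [g hg] := at_wall_eq0 (at_wall_coef hinv dj).
have [||C Cinv gC] := @semi_invariant_wall_div g.
- move=> b bW; apply: (mulfI l_neq0).
  by have := hW b bW; rewrite hg rmorphM /= (shear_wall W_max).
- apply: (mulfI l_neq0).
  by move: hd; rewrite hg rmorphM /= dilation_wall -scalerAl scalerAr.
exists (C, C * l ^+ e.-1 * u j); split=> //=.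
rewrite /basic_form (negbTE jm) (negbTE dj) /= /koszul hg gC.
exact: koszul_row_split.
Qed.

Lemma dl_inj (g h : mp) : g *: dfrm l = h *: dfrm l :> oneform F n.+1 -> g = h.
Proof.
move/(congr1 (fun w : oneform F n.+1 => w 0 ord_max)).
by rewrite dfrmX 4!mxE !eqxx !mulr1.
Qed.

(** Since dl has weight [mu], [h] has the inverse weight and is divisible by l^(e-1), while d(l^e) =
    e l^(e-1) dl. *)
Lemma wall_multiple h : wall_form_invariant (h *: dfrm l) ->
  exists2 C, wall_invariant C & h *: dfrm l = C *: basic_form ord_max.
Proof.
move=> [hW hd]; have [||g [gW gd] hg] := @semi_invariant_wall_div h.
- by move=> b bW; apply: dl_inj; rewrite -[RHS](hW b bW) fsubstZ -dfrm_msubst (shear_wall W_max).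
- apply: dl_inj; rewrite -[RHS]hd fsubstZ -dfrm_msubst dilation_wall dfrmZ scalerA.
  by rewrite -mul_mpolyC mulrC.
exists (e%:R^-1 *: g).
  by split=> [b bW|]; rewrite msubstZ ?gW ?gd.
rewrite /basic_form eqxx /= /basic_inv eqxx dfrm_wall_power scalerA hg.
rewrite -mul_mpolyC mulrACA -mpolyCM mulVf ?e_natr_neq0 // mpolyC1 mul1r.
by rewrite mulrC.
Qed.

Lemma basic_form_generate om : wall_form_invariant om ->
  exists C : 'I_n.+1 -> mp, (forall i, wall_invariant (C i)) /\
    om = \sum_i C i *: basic_form i.
Proof.
have [h ->] := linform_basis_span Mu om => hinv.
have [CH CHP] := fin_all_exists (coef_decomposition hinv).
have E : \sum_j h j *: dfrm (u j) =
    \sum_j (CH j).1 *: basic_form j + (\sum_j (CH j).2) *: dfrm l.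
  rewrite scaler_suml -big_split; apply: eq_bigr => j _.
  by have [_ ->] := CHP j.
(* The remaining multiple of dl is a difference of invariant forms, hence invariant. *)
have [C0 C0inv HC] : exists2 C, wall_invariant C &
    (\sum_j (CH j).2) *: dfrm l = C *: basic_form ord_max.
  apply: wall_multiple.
  have -> : (\sum_j (CH j).2) *: dfrm l =
      \sum_j h j *: dfrm (u j) - \sum_j (CH j).1 *: basic_form j by rewrite E addrC addKr.
  apply: wall_form_invariantB => //; apply: wall_form_invariant_sum => i _.
  by apply: wall_form_invariantZ (basic_form_invariant i); have [] := CHP i.
exists (fun j => (CH j).1 - (if j == ord_max then - C0 else 0)); split.
  move=> i; apply: wall_invariantB; first by have [] := CHP i.
  case: ifP => _; last by split=> [b bW|]; rewrite rmorph0.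
  by have [C0W C0d] := C0inv; split=> [b bW|]; rewrite rmorphN /= ?C0W ?C0d.
rewrite E HC (bigD1 ord_max) // [RHS](bigD1 ord_max) //= eqxx opprK scalerDl.
rewrite -addrA [X in _ + X]addrC addrA; congr (_ + _).
apply: eq_bigr => j /negbTE jm; rewrite jm; congr (_ *: _); exact/esym/subr0.
Qed.

End BasicInvariants.

(** * Normal form of a group that fixes a hyperplane pointwise *)

(** Multiplication by [u] permutes [A], so the nonzero product of the elements of [A] equals itself
    times [u ^+ #|A|]. *)
Lemma stable_set_expr (F : finFieldType) (A : {set F}) u :
  (forall v, v \in A -> v != 0) -> u != 0 -> (forall v, v \in A -> u * v \in A) ->
  u ^+ #|A| = 1.
Proof.
move=> A0 u0 uA; have im : [set u * v | v in A] = A.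
  apply/eqP; rewrite eqEcard (card_imset _ (mulfI u0)) leqnn andbT.
  by apply/subsetP => _ /imsetP[v vA ->]; apply: uA.
have p0 : \prod_(v in A) v != 0 by apply/prodf_neq0.
apply: (mulIf p0); rewrite mul1r -[in RHS]im big_imset /=; last by move=> ? ? _ _ /(mulfI u0).
by rewrite big_split /= prodr_const.
Qed.

Section HyperplaneGroups.
Variables (F : finFieldType) (n : nat).
Implicit Types (b : 'rV[F]_n.+1) (A P : 'M[F]_n.+1).
Notation ev := (delta_mx ord_max 0 : 'cV[F]_n.+1).

Lemma shear0 : shear 0 = 1%:M :> 'M[F]_n.+1.
Proof. by rewrite /shear mulmx0 addr0. Qed.

Lemma mul_row_ev b : b *m ev = (b 0 ord_max)%:M.
Proof. by apply/matrixP => i j; rewrite !ord1 -colE !mxE eqxx mulr1n. Qed.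

Lemma shearM b b' : shear b *m shear b' = shear (b + b' + b 0 ord_max *: b').
Proof.
rewrite /shear mulmxDl mul1mx mulmxDr mulmx1 mulmxA -[ev *m b *m ev]mulmxA mul_row_ev.
rewrite mul_mx_scalar -scalemxAl scalemxAr -addrA -2!mulmxDr; congr (_ + _ *m _).
by rewrite addrCA addrA.
Qed.

Lemma shear_max_max b : shear b ord_max ord_max = 1 + b 0 ord_max.
Proof. by rewrite shearE eqxx mul1r. Qed.

Lemma shearX b k :
  shear b ^+ k = shear ((\sum_(i < k) (1 + b 0 ord_max) ^+ i) *: b).
Proof.
elim: k => [|k IH]; first by rewrite big_ord0 scale0r shear0 expr0.
set m := 1 + _ in IH *.
have -> : \sum_(i < k.+1) m ^+ i = 1 + m * \sum_(i < k) m ^+ i.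
  by rewrite big_ord_recl expr0 mulr_sumr; congr (_ + _); apply: eq_bigr => i _; rewrite exprS.
rewrite exprS IH -mulmxE shearM; congr (shear _).
by rewrite scalerDl scale1r -addrA; congr (_ + _); rewrite -scalerA scalerDl scale1r.
Qed.

(** The geometric sum in [shearX] vanishes, its product with the nonzero m - 1 being m^N - 1 = 0. *)
Lemma shear_exp_order b N : 1 + b 0 ord_max != 1 -> (1 + b 0 ord_max) ^+ N = 1 ->
  shear b ^+ N = 1.
Proof.
move=> m1 mN; rewrite shearX; set m := 1 + _ in m1 mN *.
have /eqP : (m - 1) * \sum_(i < N) m ^+ i = 0 by rewrite -subrX1 mN subrr.
by rewrite mulf_eq0 subr_eq0 (negbTE m1) /= => /eqP ->; rewrite scale0r shear0.
Qed.

Lemma dilationX (mu : F) k : dilation n mu ^+ k = dilation n (mu ^+ k).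
Proof.
elim: k => [|k IH].
  rewrite expr0; apply/matrixP => i j; rewrite !mxE expr0 if_same.
  by case: eqP.
rewrite exprS IH -mulmxE mulmx_diag; congr diag_mx.
by apply/rowP => i; rewrite !mxE; case: eqP; rewrite ?mulr1 // exprS.
Qed.

Lemma dilation1 : dilation n 1 = 1%:M :> 'M[F]_n.+1.
Proof. by have := dilationX 1 0; rewrite expr0 => <-. Qed.

Lemma dilation_max_max mu : dilation n mu ord_max ord_max = mu :> F.
Proof. by rewrite !mxE !eqxx mulr1n. Qed.

Lemma dilation_shear mu b : b 0 ord_max = 0 ->
  dilation n mu *m shear b = shear (mu *: b) *m dilation n mu.
Proof.
move=> bm; have bd : b *m dilation n mu = b.
  apply/rowP => j; rewrite mul_mx_diag !mxE; case: eqP => [->|_]; last by rewrite mulr1.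
  by rewrite bm mul0r.
have de : dilation n mu *m ev = mu *: ev.
  apply/colP => j; rewrite mul_diag_mx !mxE; case: eqP => [_|_] //=.
  by rewrite !mulr0.
rewrite /shear mulmxDl mulmxDr mul1mx mulmx1 !mulmxA de.
congr (_ + _); rewrite -[RHS]mulmxA -[(mu *: b) *m _]scalemxAl bd -scalemxAl.
by rewrite -scalemxAr.
Qed.

Lemma fixes_wall_shear A : (forall i, i != ord_max -> row i A = delta_mx 0 i) ->
  A = shear (row ord_max A - delta_mx 0 ord_max).
Proof.
move=> rA; apply/matrixP => i j; rewrite shearE !mxE eqxx /=.
have [->|im] := eqVneq i ord_max; first by rewrite mul1r (eq_sym ord_max) [RHS]addrC subrK.
by have := congr1 (fun v : 'rV_n.+1 => v 0 j) (rA i im); rewrite !mxE eqxx mul0r addr0 eq_sym.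
Qed.

End HyperplaneGroups.

Section HyperplaneGroup.
Variables (F : finFieldType) (n : nat) (G : {set 'M[F]_n.+1}) (l : 'cV[F]_n.+1) (e : nat).
Hypotheses (G1 : 1%:M \in G) (GM : forall g h, g \in G -> h \in G -> g *m h \in G)
  (GU : forall g, g \in G -> g \in unitmx) (l_neq0 : l != 0)
  (Gfix : forall g (v : 'rV[F]_n.+1), g \in G -> v *m l = 0 -> v *m g = v)
  (Ge : max_diag_refl_order G e).
Notation ev := (delta_mx ord_max 0 : 'cV[F]_n.+1).
Implicit Types (g P Q : 'M[F]_n.+1) (b : 'rV[F]_n.+1).

Lemma group_exp g k : g \in G -> g ^+ k \in G.
Proof.
by move=> gG; elim: k => [|k IH]; rewrite ?expr0 // exprS -mulmxE GM.
Qed.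

(** Left multiplication by [g] is injective on the finite set [G], hence reaches 1. *)
Lemma group_inv g : g \in G -> invmx g \in G.
Proof.
move=> gG; have gU := GU gG.
have im : [set g *m h | h in G] = G.
  apply/eqP; rewrite eqEcard card_in_imset; last first.
    by move=> h k _ _ /(congr1 (mulmx (invmx g))); rewrite !mulKmx.
  by rewrite leqnn andbT; apply/subsetP => _ /imsetP[h hG ->]; apply: GM.
by have := G1; rewrite -{1}im => /imsetP[h hG E]; rewrite -[invmx g]mulmx1 E mulKmx.
Qed.

(** In the rank factorization of [l] the right factor is 1 x 1, a scalar; undoing the left factor
    gives a multiple of the first unit column, which a transposition moves to the last. *)
Lemma column_to_ev : exists2 P, P \in unitmx & P *m l = ev.
Proof.
have r1 : \rank l = 1%N.
  by apply/eqP; rewrite eqn_leq rank_leq_col lt0n mxrank_eq0.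
pose R := row_ebase l; pose C := col_ebase l.
have [r RE] : exists r, R = r%:M by exists (R 0 0); apply: mx11_scalar.
have r0 : r != 0.
  by have := row_ebase_unit l; rewrite unitmxE -/R RE det_scalar1 unitfE.
exists (r^-1 *: (tperm_mx 0 ord_max *m invmx C)).
  by rewrite unitmxZ ?unitfE ?invr_eq0 // unitmx_mul unitmx_perm unitmx_inv col_ebase_unit.
rewrite -scalemxAl -(mulmx_ebase l) r1 -/C -/R RE mul_mx_scalar -scalemxAr scalerA.
rewrite mulVf // scale1r -mulmxA mulKmx ?col_ebase_unit // -xrowE.
apply/colP => i; rewrite !mxE eqxx andbT.
case: tpermP => [->|->|/eqP i0 /eqP im] /=; last first.
  by have /negbTE-> : (i : nat) != 0%N by []; rewrite (negbTE im).
  by rewrite -val_eqE /= eqxx.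
by rewrite -val_eqE /=; case: (n).
Qed.

Section Conjugation.
Variable P : 'M[F]_n.+1.
Hypotheses (Pu : P \in unitmx) (Pl : P *m l = ev).

Definition gconj g := P *m g *m invmx P.

Lemma gconjM g h : gconj (g *m h) = gconj g *m gconj h.
Proof. by rewrite /gconj !mulmxA mulmxKV. Qed.

Lemma gconj1 : gconj 1%:M = 1%:M.
Proof. by rewrite /gconj mulmx1 mulmxV. Qed.

Lemma gconjX g k : gconj (g ^+ k) = gconj g ^+ k.
Proof.
elim: k => [|k IH]; first by rewrite !expr0 gconj1.
by rewrite !exprS -!mulmxE gconjM IH.
Qed.

Lemma gconjK g : invmx P *m gconj g *m P = g.
Proof. by rewrite /gconj !mulmxA mulVmx // mul1mx mulmxKV. Qed.

Lemma gconj_inj : injective gconj.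
Proof. by move=> g h E; rewrite -(gconjK g) E gconjK. Qed.

Lemma gconjV g : gconj (invmx P *m g *m P) = g.
Proof. by rewrite /gconj !mulmxA mulmxV // mul1mx mulmxK. Qed.

Lemma gconj_shear g : g \in G -> exists b, gconj g = shear b.
Proof.
move=> gG; exists (row ord_max (gconj g) - delta_mx 0 ord_max).
apply: fixes_wall_shear => i im.
have ril : row i P *m l = 0.
  by rewrite -row_mul Pl; apply/rowP => j; rewrite !mxE (negbTE im).
by rewrite /gconj 2!row_mul (Gfix gG ril) -row_mul mulmxV // row1.
Qed.

(** On [G] this is the determinant of [g], since the conjugate is a shear. *)
Definition gmult g := gconj g ord_max ord_max.

Lemma gmultM g h : g \in G -> h \in G -> gmult (g *m h) = gmult g * gmult h.
Proof.
move=> gG hG; rewrite /gmult gconjM.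
have [b ->] := gconj_shear gG; have [b' ->] := gconj_shear hG.
by rewrite shearM !shear_max_max !mxE; ring.
Qed.

Lemma gmult1 : gmult 1%:M = 1.
Proof. by rewrite /gmult gconj1 mxE eqxx. Qed.

Lemma gmult_neq0 g : g \in G -> gmult g != 0.
Proof.
move=> gG; apply/eqP => g0; have := gmultM gG (group_inv gG).
by rewrite mulmxV ?GU // gmult1 g0 mul0r => /eqP; rewrite oner_eq0.
Qed.

Definition gmults := [set gmult g | g in G].

Lemma gmult_exp g : g \in G -> gmult g ^+ #|gmults| = 1.
Proof.
move=> gG; apply: stable_set_expr; last 1 first.
- by move=> _ /imsetP[h hG ->]; rewrite -gmultM // imset_f // GM.
- by move=> _ /imsetP[h hG ->]; apply: gmult_neq0.
- exact: gmult_neq0.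
Qed.

(** A finite subgroup of the units of a field is cyclic. *)
Lemma gmult_prim : exists2 s, s \in G & #|gmults|.-primitive_root (gmult s).
Proof.
have N0 : (0 < #|gmults|)%N by apply/card_gt0P; exists (gmult 1%:M); apply: imset_f.
have /hasP[z] : has #|gmults|.-primitive_root (enum gmults).
  apply: has_prim_root => //; rewrite ?enum_uniq -?cardE //.
  apply/allP => z; rewrite mem_enum => /imsetP[g gG ->].
  by rewrite unity_rootE gmult_exp.
by rewrite mem_enum => /imsetP[s sG ->]; exists s.
Qed.

Lemma group_exp_order g : g \in G -> gmult g != 1 -> g ^+ #|gmults| = 1.
Proof.
move=> gG; have := gmult_exp gG; rewrite /gmult.
have [b gb] := gconj_shear gG; rewrite {1 2}gb shear_max_max => mN m1.
by apply: gconj_inj; rewrite gconjX gb shear_exp_order // [RHS]gconj1.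
Qed.

(** Here (g - 1)^2 = 0, so a diagonalizable [g] would be the identity, whose fixed space is not a
    hyperplane. *)
Lemma unipotent_not_diag g : g \in G -> gmult g = 1 -> ~ diag_reflection g.
Proof.
move=> gG; rewrite /gmult; have [b gb] := gconj_shear gG.
rewrite gb shear_max_max => /(canRL (addKr 1)); rewrite addNr => b0.
move=> [[_ _ rk] [Q Qu Qc]].
have /is_diag_mxP Qd : is_diag_mx (Q *m g *m invmx Q) by rewrite -conjumx.
have g1 : g - 1%:M = invmx P *m (ev *m b) *m P.
  rewrite -{1}(gconjK g) gb /shear mulmxDr mulmx1 mulmxDl mulVmx //.
  by rewrite addrAC subrr add0r.
have sq : (g - 1%:M) *m (g - 1%:M) = 0.
  rewrite g1 !mulmxA mulmxK // -[_ *m b *m ev]mulmxA mul_row_ev b0.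
  by rewrite -scalemx1 scale0r mulmx0 !mul0mx.
have [D DE] : exists D, D = Q *m (g - 1%:M) *m invmx Q by exists (Q *m (g - 1%:M) *m invmx Q).
have D2 : D *m D = 0 by rewrite DE !mulmxA mulmxKV // -[_ *m _ *m (g - _)]mulmxA sq mulmx0 mul0mx.
have Dij i j : i != j -> D i j = 0.
  move=> ij; rewrite DE mulmxBr mulmxBl mulmx1 mulmxV // [LHS]mxE Qd // add0r [LHS]mxE.
  by rewrite [1%:M i j]mxE (negbTE ij) oppr0.
have D0 : D = 0.
  apply/matrixP => i j; rewrite [RHS]mxE; have [<-|] := eqVneq i j; last exact: Dij.
  have := congr1 (fun A : 'M[F]_n.+1 => A i i) D2.
  rewrite [RHS]mxE [LHS]mxE (bigD1 i) //= big1 ?addr0 => [|k ki].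
    by move/eqP; rewrite mulf_eq0 orbb => /eqP.
  by rewrite (Dij k i) ?mulr0.
have g0 : g - 1%:M = 0.
  by rewrite -[g - _](mulKmx Qu) -[Q *m _](mulmxKV Qu) -DE D0 mul0mx mulmx0.
by move: rk; rewrite mxrank_ker g0 mxrank0 subn0 => /eqP; rewrite eqn_leq ltnn.
Qed.

End Conjugation.

Lemma shear_wall_unit b : b 0 ord_max = 0 ->
  shear b \in unitmx /\ invmx (shear b) = shear (- b).
Proof.
move=> bm; have E : shear b *m shear (- b) = 1%:M.
  by rewrite shearM bm scale0r addr0 subrr shear0.
have [Ru _] := mulmx1_unit E; split => //.
by rewrite -[LHS]mulmx1 -E mulKmx.
Qed.

Lemma shear_to_dilation b : b 0 ord_max != 0 -> exists2 c : 'rV[F]_n.+1,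
  c 0 ord_max = 0 & shear c *m shear b = dilation n (1 + b 0 ord_max) *m shear c.
Proof.
(* The last row of [shear c] is then b / b_n, an eigenvector of [shear b] for the eigenvalue 1 +
   b_n. *)
move=> b0; exists ((b 0 ord_max)^-1 *: b - delta_mx 0 ord_max).
  by rewrite !mxE !eqxx mulVf // subrr.
set c := _ - _; have cm : c 0 ord_max = 0 by rewrite !mxE !eqxx mulVf // subrr.
rewrite dilation_shear // shearM cm scale0r addr0.
apply/matrixP => i j; rewrite mul_mx_diag [RHS]mxE 2!shearE !mxE !eqxx /=.
have [->|jm] := eqVneq j ord_max.
  by rewrite mulVf // subrr; case: (i == ord_max); field.
by case: (i == ord_max); rewrite ?mul1r ?mul0r ?subr0 ?mulr1 //; move: (_%:R) => z; field.
Qed.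

Lemma has_order_dilation P s mu N : P \in unitmx -> gconj P s = dilation n mu ->
  N.-primitive_root mu -> has_order s N.
Proof.
move=> Pu sd muN; split; first exact: prim_order_gt0 muN.
  apply: (gconj_inj Pu); rewrite gconjX // sd dilationX (prim_expr_order muN).
  by rewrite dilation1 [RHS]gconj1.
move=> j /andP[j0 jN] sj.
have /(congr1 (fun A : 'M[F]_n.+1 => A ord_max ord_max)) := gconjX Pu s j.
rewrite sj [gconj P 1]gconj1 // sd dilationX dilation_max_max mxE eqxx => /esym/eqP.
by rewrite -(prim_order_dvd muN) => dj; have := dvdn_leq j0 dj; rewrite leqNgt jN.
Qed.

Lemma dilation_diag_reflection P s mu N : P \in unitmx -> s \in G ->
  gconj P s = dilation n mu -> mu != 1 -> N.-primitive_root mu -> diag_reflection s.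
Proof.
move=> Pu sG sd mu1 muN; split; last first.
  exists P => //; rewrite /simmx_to_for.
  have : is_diag_mx (gconj P s) by rewrite sd diag_mx_is_diag.
  by rewrite /gconj -conjumx.
split; first exact: GU.
  by exists N; apply: has_order_dilation Pu sd muN.
have s1 : s != 1%:M.
  apply: contraNneq mu1 => s1; have := congr1 (fun A : 'M[F]_n.+1 => A ord_max ord_max) sd.
  by rewrite s1 gconj1 // dilation_max_max mxE eqxx => <-.
have dE : dilation n mu = shear ((mu - 1) *: delta_mx 0 ord_max).
  apply/matrixP => i j; rewrite shearE !mxE eqxx /=.
  have [->|ij] := eqVneq i j; last first.
    have [im|] := eqVneq i ord_max; last by rewrite !mul0r addr0.
    by rewrite mul1r -im eq_sym (negbTE ij) mulr0 addr0.
  by case: (eqVneq j ord_max) => _; rewrite ?mul1r ?mulr1 ?mul0r ?addr0 // addrC subrK.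
have rs : \rank (s - 1%:M) = 1%N.
  apply/eqP; rewrite eqn_leq lt0n mxrank_eq0 subr_eq0 s1 andbT.
  have -> : s - 1%:M = invmx P *m ev *m (((mu - 1) *: delta_mx 0 ord_max) *m P).
    rewrite -{1}(gconjK Pu s) sd dE /shear mulmxDr mulmx1 mulmxDl mulVmx //.
    by rewrite addrAC subrr add0r !mulmxA.
  exact: mulmx_max_rank.
by rewrite mxrank_ker rs subn1.
Qed.

(** Let N be the number of values of [gmult]; the point is e = N. If N = 1 there is no
    diagonalizable reflection. Otherwise an element whose [gmult] is a primitive N-th root of unity
    is conjugate to a dilation, so it is a diagonalizable reflection of order N, and every
    diagonalizable reflection g satisfies g^N = 1. *)
Lemma normalized_conjugation : exists P mu, [/\ P \in unitmx, P *m l = ev,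
  e.-primitive_root mu, invmx P *m dilation n mu *m P \in G &
  forall g, g \in G -> exists k, gmult P g = mu ^+ k].
Proof.
have [P Pu Pl] := column_to_ev.
have [s sG sN] := gmult_prim Pu Pl; set N := #|_| in sN.
have [N1|N1] := eqVneq N 1%N.
  have m1 g : g \in G -> gmult P g = 1.
    by move=> gG; rewrite -[LHS]expr1 -N1 gmult_exp.
  have e1 : e = 1%N.
    case: Ge => [[]//|[[g gG [gd _]] _]].
    by case: (unipotent_not_diag Pu Pl gG (m1 g gG) gd).
  exists P, 1; split => //.
  - by rewrite e1 -N1 -(m1 s sG).
  - by rewrite dilation1 mulmx1 mulVmx.
  - by move=> g gG; exists 0%N; rewrite m1.
have [b sb] := gconj_shear Pu Pl sG.
have sm : gmult P s = 1 + b 0 ord_max by rewrite /gmult sb shear_max_max.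
set mu := gmult P s in sN sm.
have mu1 : mu != 1.
  apply: contraNneq N1 => m1; rewrite -dvdn1 (prim_order_dvd sN) m1 expr1 //.
have b0 : b 0 ord_max != 0 by apply: contraNneq mu1 => b0; rewrite sm b0 addr0.
have [c cm cb] := shear_to_dilation b0.
have [Ru Ri] := shear_wall_unit cm.
pose P' := shear c *m P.
have P'u : P' \in unitmx by rewrite unitmx_mul Ru.
have P'g g : gconj P' g = shear c *m gconj P g *m invmx (shear c).
  apply: (@mulIr _ P'); rewrite ?P'u //.
  rewrite -!mulmxE mulmxKV // /P' /gconj !mulmxA.
  by rewrite mulmxKV // mulmxKV.
have sd : gconj P' s = dilation n mu by rewrite P'g sb cb -sm mulmxK.
have sR : diag_reflection s := dilation_diag_reflection P'u sG sd mu1 sN.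
have eN : e = N.
  case: Ge => [[nr _]|[[g gG [gd [e0 _ ge]]] emax]]; first by case: (nr s sG sR).
  have le_Ne := emax s N sG sR (has_order_dilation P'u sd sN).
  apply/eqP; rewrite eqn_leq le_Ne andbT leqNgt; apply/negP => Ne; apply: (ge N).
    by rewrite Ne (prim_order_gt0 sN).
  apply: (group_exp_order Pu Pl gG); apply/eqP => m1.
  by case: (unipotent_not_diag Pu Pl gG m1 gd).
exists P', mu; split => //.
- rewrite /P' -mulmxA Pl /shear mulmxDl mul1mx -mulmxA mul_row_ev cm.
  by rewrite -scalemx1 scale0r mulmx0 addr0.
- by rewrite eN.
- by rewrite -sd gconjK.
move=> g gG; have [i gi] := prim_rootP sN (gmult_exp Pu Pl gG); exists i; rewrite -gi.
rewrite /gmult P'g Ri; have [b' ->] := gconj_shear Pu Pl gG.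
by rewrite !shearM !shear_max_max !mxE cm; ring.
Qed.

End HyperplaneGroup.

(** * The transvection group, its field of multipliers, and transport of invariance *)

Section Transport.
Variables (F : finFieldType) (n : nat) (G : {set 'M[F]_n.+1}) (l : 'cV[F]_n.+1) (e : nat).
Hypotheses (G1 : 1%:M \in G) (GM : forall g h, g \in G -> h \in G -> g *m h \in G)
  (GU : forall g, g \in G -> g \in unitmx)
  (Gfix : forall g (v : 'rV[F]_n.+1), g \in G -> v *m l = 0 -> v *m g = v).
Variables (P : 'M[F]_n.+1) (mu : F).
Hypotheses (Pu : P \in unitmx) (Pl : P *m l = delta_mx ord_max 0)
  (mu_prim : e.-primitive_root mu) (GD : invmx P *m dilation n mu *m P \in G)
  (Gmult : forall g, g \in G -> exists k, gmult P g = mu ^+ k).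
Implicit Types (g : 'M[F]_n.+1) (b : 'rV[F]_n.+1).

Definition transvections : {set 'rV[F]_n.+1} :=
  [set b : 'rV[F]_n.+1 | (b 0 ord_max == 0) && (invmx P *m shear b *m P \in G)].
Local Notation W := transvections.

Definition multipliers : {set F} := [set t | [forall b in W, t *: b \in W]].
Local Notation K := multipliers.

Lemma transvectionsP b :
  reflect (b 0 ord_max = 0 /\ invmx P *m shear b *m P \in G) (b \in W).
Proof.
by rewrite inE; apply: (iffP andP) => -[bm bG]; split => //; [exact/eqP | rewrite bm].
Qed.

Lemma multipliersP t : reflect (forall b, b \in W -> t *: b \in W) (t \in K).
Proof.
by rewrite inE; apply: (iffP forall_inP).
Qed.

Lemma transvections_max b : b \in W -> b 0 ord_max = 0.
Proof. by case/transvectionsP. Qed.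

Lemma transvections0 : 0 \in W.
Proof. by apply/transvectionsP; rewrite mxE shear0 mulmx1 mulVmx. Qed.

Lemma transvectionsD b b' : b \in W -> b' \in W -> b + b' \in W.
Proof.
move=> /transvectionsP[bm bG] /transvectionsP[bm' bG']; apply/transvectionsP.
split; first by rewrite mxE bm bm' addr0.
have := GM bG bG'; rewrite !mulmxA mulmxK // -(mulmxA (invmx P) (shear b)) shearM.
by rewrite bm scale0r addr0.
Qed.

Lemma multipliers0 : 0 \in K.
Proof. by apply/multipliersP => b _; rewrite scale0r transvections0. Qed.

Lemma multipliers1 : 1 \in K.
Proof. by apply/multipliersP => b; rewrite scale1r. Qed.

Lemma multipliersD s t : s \in K -> t \in K -> s + t \in K.
Proof.
move=> /multipliersP sK /multipliersP tK; apply/multipliersP => b bW.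
by rewrite scalerDl transvectionsD ?sK ?tK.
Qed.

Lemma multipliersM s t : s \in K -> t \in K -> s * t \in K.
Proof.
move=> /multipliersP sK /multipliersP tK; apply/multipliersP => b bW.
by rewrite -scalerA sK ?tK.
Qed.

(** Conjugating the transvection of [b] by the dilation gives that of [mu *: b]. *)
Lemma multipliers_mu : mu \in K.
Proof.
apply/multipliersP => b /transvectionsP[bm bG]; apply/transvectionsP.
split; first by rewrite mxE bm mulr0.
have := GM (GM GD bG) (group_inv G1 GM GU GD); congr (_ \in G).
have E : invmx P *m dilation n mu *m P *m (invmx P *m shear b *m P) =
    invmx P *m shear (mu *: b) *m P *m (invmx P *m dilation n mu *m P).
  by rewrite !mulmxA !mulmxK // -(mulmxA (invmx P) (dilation n mu)) dilation_shear // mulmxA.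
by rewrite E mulmxK // GU.
Qed.

(** [K] is a subgroup of the additive group of F, which is an elementary abelian group for the prime
    [ch]. *)
Lemma multipliers_pnat ch : ch \in [pchar F] -> ch.-nat #|K|.
Proof.
move=> chF; have gK : group_set K.
  by apply/group_setP; split=> [|s t]; [exact: multipliers0 | exact: multipliersD].
have := pgroupS (subsetT (Group gK)) (abelem_pgroup (fin_ring_pchar_abelem chF)).
by [].
Qed.

Lemma multipliers_card_gt1 : (1 < #|K|)%N.
Proof.
rewrite (cardsD1 0) multipliers0 (cardsD1 1) !inE oner_eq0.
by have := multipliers1; rewrite inE => ->.
Qed.

Lemma multipliers_exp_pred t : t \in K -> t != 0 -> t ^+ #|K|.-1 = 1.
Proof.
move=> tK t0; rewrite (cardsD1 0) multipliers0 add1n /=; apply: stable_set_expr => //.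
  by move=> v; rewrite in_setD1 => /andP[].
by move=> v; rewrite !in_setD1 => /andP[v0 vK]; rewrite mulf_neq0 // multipliersM.
Qed.

Lemma multipliers_exp t : t \in K -> t ^+ #|K| = t.
Proof.
move=> tK; have K0 := ltnW multipliers_card_gt1.
have [->|t0] := eqVneq t 0; first by rewrite expr0n gtn_eqF.
by rewrite -(prednK K0) exprS multipliers_exp_pred // mulr1.
Qed.

(** Dividing [g] by the power of the dilation with the same [gmult] leaves an element with [gmult]
    1, that is, a transvection or 1. *)
Lemma group_decomposition g : g \in G ->
  exists k b, b \in W /\ gconj P g = dilation n mu ^+ k *m shear b.
Proof.
move=> gG; have [k gk] := Gmult gG; pose X := invmx P *m dilation n mu *m P.
have XG : X ^+ k \in G by apply: group_exp.
have XV : gconj P (X ^+ k) = dilation n mu ^+ k by rewrite gconjX // gconjV.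
have hG : invmx (X ^+ k) *m g \in G by rewrite GM ?group_inv.
have gE : g = X ^+ k *m (invmx (X ^+ k) *m g) by rewrite mulKVmx // GU.
have [b hb] := gconj_shear Gfix Pu Pl hG.
exists k, b; split; last by rewrite [in LHS]gE gconjM // XV hb.
apply/transvectionsP; split; last by rewrite -hb gconjK.
have := gmultM Gfix Pu Pl XG hG; rewrite -gE gk {1}/gmult XV dilationX dilation_max_max.
rewrite /gmult hb shear_max_max => /eqP; rewrite -{1}[mu ^+ k]mulr1 => /eqP.
have mk0 : mu ^+ k != 0 by rewrite expf_neq0 // (prim_root_neq0 mu_prim).
by move/(mulfI mk0)/esym/(canRL (addKr 1)); rewrite addNr.
Qed.

(** An abstract action serves polynomials and forms alike; [invmx g] appears because [act_poly] and
    [act_form] substitute the inverse matrix. *)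
Lemma invariant_transport (T : Type) (act : 'M[F]_n.+1 -> T -> T) h :
  (forall A B x, act B (act A x) = act (B *m A) x) -> (forall x, act 1%:M x = x) ->
  (forall g, g \in G -> act (invmx g) h = h) <->
  ((forall b, b \in W -> act (shear b) (act P h) = act P h) /\
   act (dilation n mu) (act P h) = act P h).
Proof.
move=> actM act1; have key g : act (gconj P g) (act P h) = act P (act g h).
  by rewrite !actM /gconj mulmxKV.
split=> [inv|[invW invD] g gG].
  have invG g : g \in G -> act g h = h.
    by move=> gG; rewrite -[g]invmxK inv // group_inv.
  split=> [b /transvectionsP[_ bG]|].
    by rewrite -(gconjV Pu (shear b)) key invG.
  by rewrite -(gconjV Pu (dilation n mu)) key invG.
have invDk k : act (dilation n mu ^+ k) (act P h) = act P h.
  by elim: k => [|k IH]; rewrite ?expr0 ?act1 // exprS -mulmxE -actM IH.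
have {}gG : invmx g \in G by apply: group_inv.
have [k [b [bW gE]]] := group_decomposition gG.
have := key (invmx g); rewrite gE -actM invW // invDk => /(congr1 (act (invmx P))).
by rewrite !actM ?mulmxA mulVmx // mul1mx act1.
Qed.

End Transport.

(** * Return to the original coordinates *)

Lemma comp_mpoly_homog (R : comNzRingType) (n k : nat) (t : n.-tuple {mpoly R[k]})
    (p : {mpoly R[n]}) d :
  (forall i, tnth t i \is 1.-homog) -> p \is d.-homog -> p \mPo t \is d.-homog.
Proof.
move=> th /dhomogP ph; rewrite comp_mpolyEX big_seq.
apply: rpred_sum => m /ph md; rewrite rpredZ // comp_mpolyX -md /= mdegE.
elim/big_rec2: _ => [|i a q _ qh]; first exact: dhomog1.
by rewrite addnC mulrC dhomogM // -[X in X.-homog]mul1n dhomogMn.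
Qed.

Lemma msubst_homog (F : finFieldType) (n : nat) (A : 'M[F]_n) (p : {mpoly F[n]}) d :
  p \is d.-homog -> msubst A p \is d.-homog.
Proof.
apply: comp_mpoly_homog => i; rewrite tnth_mktuple; apply: rpred_sum => j _.
by rewrite mul_mpolyC rpredZ // dhomogX; apply/eqP/mdeg1.
Qed.

Lemma msubst_lin_form_poly (F : finFieldType) (n : nat) (A : 'M[F]_n) (v : 'cV[F]_n) :
  msubst A (lin_form_poly v) = lin_form_poly (A *m v).
Proof.
rewrite rmorph_sum /=.
under eq_bigr => i _ do rewrite rmorphM /= msubstC msubstX mul_mpolyC scaler_sumr.
rewrite exchange_big /=; apply: eq_bigr => j _.
rewrite mxE mul_mpolyC scaler_suml; apply: eq_bigr => i _.
by rewrite scalerA mulrC.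
Qed.

Lemma lin_form_poly_delta (F : finFieldType) (n : nat) (i : 'I_n) :
  lin_form_poly (delta_mx i 0 : 'cV[F]_n) = 'X_i.
Proof.
rewrite /lin_form_poly (bigD1 i) //= big1 ?addr0 => [|j ji].
  by rewrite mxE !eqxx mpolyC1 mul1r.
by rewrite mxE (negbTE ji) mpolyC0 mul0r.
Qed.

Theorem theorem6p1 (F : finFieldType) (n : nat) (G : {set 'M[F]_n})
  (l : 'cV[F]_n) (e : nat) :
  (2 \notin [pchar F])%N ->
  (* G is a (finite) subgroup of GL(V) *)
  1%:M \in G ->
  (forall g h, g \in G -> h \in G -> g *m h \in G) ->
  (forall g, g \in G -> g \in unitmx) ->
  (* l is a nonzero linear form, defining the hyperplane H = ker l *)
  l != 0 ->
  (* G fixes H pointwise *)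
  (forall g (v : 'rV[F]_n), g \in G -> v *m l = 0 -> v *m g = v) ->
  max_diag_refl_order G e ->
  exists (fs : n.-tuple {mpoly F[n]}) (a : 'I_n -> nat) (w : 'I_n -> oneform F n),
    [/\ (* basic invariants *)
        (forall i, poly_invariant G (tnth fs i) /\
                   exists d, tnth fs i \is d.-homog),
        (forall p : {mpoly F[n]}, comp_mpoly fs p = 0 -> p = 0),
        (forall h, poly_invariant G h -> exists p, h = comp_mpoly fs p),
        (* (l^e)^(a_i) divides df_i for i < n (with a_n = 0) *)
        (forall i : 'I_n, i.+1 = n -> a i = 0%N) /\
        (forall i, dfrm (tnth fs i) = (lin_form_poly l ^+ (e * a i)) *: w i)
      & (* the quotients lie in and generate (Omega^1)^G over F[V]^G *)
        (forall i, form_invariant G (w i)) /\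
        (forall om, form_invariant G om ->
           exists c : 'I_n -> {mpoly F[n]},
             (forall i, poly_invariant G (c i)) /\
             om = \sum_(i < n) c i *: w i)].
Proof.
case: n G l => [|n] G l pchar2 G1 GM GU l0 Gfix Ge.
  (* In dimension 0 there is no nonzero linear form. *)
  by case/eqP: l0; apply/matrixP => -[].
have [P [mu [Pu Pl mu_prim GD Gmult]]] := normalized_conjugation G1 GM GU l0 Gfix Ge.
pose W := transvections G P; pose K := multipliers G P; pose q := #|K|.
have [ch _ chF] := finPcharP F.
have q_ch : ch.-nat q := multipliers_pnat G1 GM Pu chF.
have q_gt1 : (1 < q)%N := multipliers_card_gt1 G1 Pu.
have W_scale t b : t \in K -> b \in W -> t *: b \in W by move/multipliersP; apply.
have W_max b : b \in W -> b 0 ord_max = 0 := @transvections_max _ _ G P b.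
have K_exp t : t \in K -> t ^+ q = t := @multipliers_exp _ _ G G1 P Pu t.
have mu_exp : mu ^+ q.-1 = 1.
  exact: (multipliers_exp_pred G1 Pu (multipliers_mu G1 GM GU Pu GD) (prim_root_neq0 mu_prim)).
have [x [d [c [M [T c0]]]]] := tower_top chF q_ch q_gt1 W_scale W_max K_exp (erefl q)
  mu_exp.
pose lP : {mpoly F[n.+1]} := 'X_ord_max.
(* Substituting [invmx P] leads back to the original coordinates and turns the last variable into
   the given linear form. *)
have lE : msubst (invmx P) lP = lin_form_poly l.
  by rewrite /lP -lin_form_poly_delta -Pl msubst_lin_form_poly mulKmx.
pose f := basic_inv e x; pose w := basic_form e x d M.
have polyT h : poly_invariant G h <-> wall_invariant W mu (msubst P h).
  exact: (invariant_transport G1 GM GU Gfix Pu Pl mu_prim GD Gmult h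
    (fun A B p => msubst_mul A B p) (@msubst1 F n.+1)).
have formT om : form_invariant G om <-> wall_form_invariant W mu (fsubst P om).
  exact: (invariant_transport G1 GM GU Gfix Pu Pl mu_prim GD Gmult om
    (fun A B p => fsubst_mul A B p) (@fsubst1 F n.+1)).
have msPK h : msubst P (msubst (invmx P) h) = h by rewrite msubst_mul mulmxV // msubst1.
have msPV h : msubst (invmx P) (msubst P h) = h by rewrite msubst_mul mulVmx // msubst1.
have fsPK om : fsubst P (fsubst (invmx P) om) = om by rewrite fsubst_mul mulmxV // fsubst1.
have fsPV om : fsubst (invmx P) (fsubst P om) = om by rewrite fsubst_mul mulVmx // fsubst1.
pose fs := [tuple msubst (invmx P) (f i) | i < n.+1].
have fsE p : p \mPo fs = msubst (invmx P) (p \mPo [tuple f i | i < n.+1]).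
  by rewrite /msubst comp_mpolyA; apply: eq_comp_mpoly => i; rewrite !tnth_mktuple.
exists fs, (wall_quotient_exp q e d), (fun i => fsubst (invmx P) (w i)); split.
- move=> i; rewrite tnth_mktuple; split.
    by apply/polyT; rewrite msPK; apply: (basic_inv_invariant W_max mu_prim T c0).
  have [k fk] := basic_inv_homog e T i.
  by exists k; apply: msubst_homog.
- move=> p; rewrite fsE => /(congr1 (msubst P)); rewrite msPK rmorph0.
  exact: (basic_inv_alg_indep chF q_ch q_gt1 mu_exp mu_prim T).
- move=> h /polyT /(basic_inv_generate mu_prim T) [p hp].
  by exists p; rewrite fsE -hp msPV.
- split=> [i [] /eqP im|i].
    by rewrite /wall_quotient_exp -val_eqE /= im.
  rewrite tnth_mktuple dfrm_msubst (dfrm_basic_inv q_gt1 mu_exp mu_prim T).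
  by rewrite fsubstZ rmorphXn /= lE.
- split=> [i|om /formT].
    by apply/formT; rewrite fsPK; apply: (basic_form_invariant W_max mu_prim T c0).
  move/(basic_form_generate chF q_ch q_gt1 W_max mu_exp mu_prim T c0) => [C [CW omE]].
  exists (fun i => msubst (invmx P) (C i)); split=> [i|].
    by apply/polyT; rewrite msPK.
  by rewrite -[om]fsPV omE fsubst_sum; apply: eq_bigr => i _; rewrite fsubstZ.
Qed.
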